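(* There is a deterministic algorithm that recovers any real non-negative vector $\mathbf{x}\in\mathbb{R}^N_+$, where $N=2^J$ with $J>0$, from its discrete Fourier transform $\widehat{\mathbf{x}}=\mathbf{F}_N\mathbf{x}\in\mathbb{C}^N$, with no a priori knowledge about the sparsity of $\mathbf{x}$ or about bounds for its support length, and that has the following properties. (i) If $\mathbf{x}$ has a short support, i.e. vanishes outside a support interval of length $m<N$ ($m$ being the support length of $\mathbf{x}$), then the algorithm has an arithmetical complexity of only $\mathcal{O}(m\log m\,\log(N/m))$ and requires $\mathcal{O}(m\log(N/m))$ Fourier samples (entries of $\widehat{\mathbf{x}}$) for this computation. (ii) The algorithm automatically recognizes and exploits a possible short support of $\mathbf{x}$, and falls back to a usual radix-2 FFT algorithm if $\mathbf{x}$ has (almost) full support. Whether or not $\mathbf{x}$ has short support, its complexity never exceeds the $\mathcal{O}(N\log_2 N)$ of usual FFT algorithms.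
   Context: $\mathbb{R}^N_+$ denotes the set of real vectors $\mathbf{x}=(x_k)_{k=0}^{N-1}$ with non-negative entries. The Fourier matrix is $\mathbf{F}_N=(\omega_N^{jk})_{j,k=0}^{N-1}\in\mathbb{C}^{N\times N}$ with $\omega_N=e^{-2\pi\mathrm{i}/N}$, and $\widehat{\mathbf{x}}=\mathbf{F}_N\mathbf{x}$ is the discrete Fourier transform of $\mathbf{x}$. The support length $m=|\mathrm{supp}\,\mathbf{x}|$ of $\mathbf{x}\in\mathbb{R}^N_+$ is the minimal positive integer such that, for some index $\mu\in\{0,\dots,N-1\}$, $x_k=0$ for all $k\notin I:=\{(\mu+\ell)\bmod N : \ell=0,\dots,m-1\}$. The set $I$ is called the support (index) interval. It may contain indices of zero entries, but the first and last entries of the support are positive: $x_\mu>0$ and $x_{(\mu+m-1)\bmod N}>0$ (in particular $\mathbf{x}$ is nonzero). Arithmetical complexity is the number of arithmetical (floating point) operations. FFT means fast Fourier transform.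
   Formalization: In (i) each of the factors log m and log(N/m) is read as max(1, log2 of it), since the plain bounds fail at m = 1 (bound 0) and m = N-1 (only O(1) samples); for 2 <= m <= N/2 they are the stated ones. *)

(* Defs.v *)
From mathcomp Require Import all_boot all_order all_algebra.
From mathcomp Require Import complex.
From mathcomp Require Import reals exp trigo.

Set Implicit Arguments.
Unset Strict Implicit.
Unset Printing Implicit Defensive.

Import Order.TTheory GRing.Theory Num.Theory.
Local Open Scope ring_scope.
Local Open Scope complex_scope.

(** * Discrete Fourier transform and support length *)

(* exp (- 2 pi i / n) *)
Definition omega (R : realType) (n : nat) : R[i] :=
  cos (2 * pi / n%:R) -i* sin (2 * pi / n%:R).

Definition fourier_mx (R : realType) (N : nat) : 'M[R[i]]_N :=
  \matrix_(j < N, k < N) omega R N ^+ (j * k).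

Definition dft (R : realType) (N : nat) (x : 'cV[R]_N) : 'cV[R[i]]_N :=
  fourier_mx R N *m map_mx (fun r : R => r%:C) x.

Definition nonneg_vec (R : realType) (N : nat) (x : 'cV[R]_N) : Prop :=
  forall k : 'I_N, 0 <= x k 0.

Definition in_interval (N mu m k : nat) : Prop :=
  exists2 l, (l < m)%N & k = ((mu + l) %% N)%N.

Definition vanishes_outside (R : realType) (N : nat) (x : 'cV[R]_N)
    (mu m : nat) : Prop :=
  forall k : 'I_N, ~ in_interval N mu m k -> x k 0 = 0.

(* The zero vector has no support length.  For a nonzero vector, minimality
   of m forces the first and last entries of the interval to be nonzero. *)
Definition support_length (R : realType) (N : nat) (x : 'cV[R]_N)
    (m : nat) : Prop :=
  [/\ x != 0, (0 < m)%N,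
      exists2 mu, (mu < N)%N & vanishes_outside x mu m
    & forall m' mu, (0 < m')%N -> (mu < N)%N -> vanishes_outside x mu m' ->
      (m <= m')%N].

(** * Model of computation

  A program is a finite text that does not depend on the problem size.  It
  acts on index registers, which hold natural numbers and serve for addressing
  and loop control, and on numeric arrays, which hold complex numbers.  An
  entry of the unknown vector's transform is only accessible through [Fetch],
  and a numeric value influences the control flow or the index registers only
  through [IfLe].

  Two costs are recorded: [flops] counts the operations on numbers, including
  comparisons, conversions of indices to numbers and evaluations of roots of
  unity; [samples] counts the reads of Fourier samples, with repetitions.
  Operations on index registers are not arithmetical operations on data and
  are not counted. *)

Inductive iexp : Type :=
| INum of nat
| IVar of nat
| IAdd of iexp & iexp
| ISub of iexp & iexp
| IMul of iexp & iexp
| IDiv of iexp & iexp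
| IMod of iexp & iexp
| IExp of iexp & iexp.

(* The cell of a numeric array, given by the array's name and an index. *)
Inductive cell : Type := Cell of nat & iexp.

Inductive arith_op : Type := OpAdd | OpSub | OpMul | OpDiv.

Inductive prog : Type :=
| Skip
| Then of prog & prog
| SetIndex of nat & iexp
| IfIndexLe of iexp & iexp & prog & prog
| For of nat & iexp & prog         (* For v e p: p for v = 0, .., e - 1 *)
| Fetch of cell & iexp
| Const of cell & iexp
| Root of cell & iexp & iexp       (* Root c n k: c := omega_n ^ k *)
| Arith of arith_op & cell & cell & cell
| IfLe of cell & cell & prog & prog.

Record state (R : realType) : Type := State {
  regs : nat -> nat;
  mem : nat -> nat -> R[i];
  flops : nat;
  samples : nat
}.

Fixpoint ieval (r : nat -> nat) (e : iexp) : nat :=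
  match e with
  | INum n => n
  | IVar v => r v
  | IAdd a b => (ieval r a + ieval r b)%N
  | ISub a b => (ieval r a - ieval r b)%N
  | IMul a b => (ieval r a * ieval r b)%N
  | IDiv a b => (ieval r a %/ ieval r b)%N
  | IMod a b => (ieval r a %% ieval r b)%N
  | IExp a b => (ieval r a ^ ieval r b)%N
  end.

Definition arith_eval (R : realType) (o : arith_op) (a b : R[i]) : R[i] :=
  match o with
  | OpAdd => a + b
  | OpSub => a - b
  | OpMul => a * b
  | OpDiv => a / b
  end.

Definition get_cell (R : realType) (s : state R) (c : cell) : R[i] :=
  let: Cell a e := c in mem s a (ieval (regs s) e).

Definition set_cell (R : realType) (s : state R) (c : cell) (z : R[i]) :
    state R :=
  let: Cell a e := c in
  let i := ieval (regs s) e in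
  State (regs s)
        (fun a' i' => if (a' == a) && (i' == i) then z else mem s a' i')
        (flops s) (samples s).

Definition set_reg (R : realType) (s : state R) (v n : nat) : state R :=
  State (fun w => if w == v then n else regs s w)
        (mem s) (flops s) (samples s).

Definition add_flop (R : realType) (s : state R) : state R :=
  State (regs s) (mem s) (flops s).+1 (samples s).

Definition add_sample (R : realType) (s : state R) : state R :=
  State (regs s) (mem s) (flops s) (samples s).+1.

Definition sample (R : realType) (N : nat) (xh : 'cV[R[i]]_N) (k : nat) :
    R[i] :=
  if insub k is Some i then xh i 0 else 0.

Fixpoint run (R : realType) (N : nat) (xh : 'cV[R[i]]_N) (p : prog)
    (s : state R) : state R :=
  match p with
  | Skip => s
  | Then p1 p2 => run xh p2 (run xh p1 s)
  | SetIndex v e => set_reg s v (ieval (regs s) e)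
  | IfIndexLe e1 e2 p1 p2 =>
      if (ieval (regs s) e1 <= ieval (regs s) e2)%N
      then run xh p1 s else run xh p2 s
  | For v e p1 =>
      foldl (fun s' i => run xh p1 (set_reg s' v i)) s
            (iota 0 (ieval (regs s) e))
  | Fetch c e => add_sample (set_cell s c (sample xh (ieval (regs s) e)))
  | Const c e => add_flop (set_cell s c (ieval (regs s) e)%:R)
  | Root c n k =>
      add_flop (set_cell s c (omega R (ieval (regs s) n)
                              ^+ ieval (regs s) k))
  | Arith o c c1 c2 =>
      add_flop (set_cell s c (arith_eval o (get_cell s c1) (get_cell s c2)))
  | IfLe c1 c2 p1 p2 =>
      if complex.Re (get_cell s c1) <= complex.Re (get_cell s c2)
      then run xh p1 (add_flop s) else run xh p2 (add_flop s)
  end.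

(* Index register 0 holds J, where 2 ^ J is the length of the vector; this is
   the only input besides the Fourier samples. *)
Definition init_state (R : realType) (J : nat) : state R :=
  State (fun v => if v == 0%N then J else 0%N) (fun _ _ => 0) 0 0.

(* The result is left in array 0.  As all cells are initially zero, a vector
   of short support can be output without writing its zero entries. *)
Definition output (R : realType) (s : state R) (k : nat) : R[i] := mem s 0 k.

(** * The radix-2 FFT

  The usual iterative decimation-in-time radix-2 FFT of length 2 ^ J, with
  J read from register 0, in the inverse direction: conjugate twiddle
  factors and a final division by 2 ^ J. *)

Section Radix2.

Local Notation J := (IVar 0).
Local Notation k := 1%N.
Local Notation i := 2%N.
Local Notation rev := 3%N.   (* bit reversal of k *)
Local Notation rest := 4%N.
Local Notation stage := 5%N.
Local Notation block := 6%N.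
Local Notation top := 7%N.
Local Notation half := 8%N.  (* 2 ^ stage *)
Local Notation A e := (Cell 0 e).
Local Notation W := (Cell 1 (INum 0)).
Local Notation V := (Cell 1 (INum 1)).
Local Notation "p ;; q" := (Then p q) (at level 60, right associativity).

Definition bit_reversal : prog :=
  SetIndex rev (INum 0) ;;
  SetIndex rest (IVar k) ;;
  For i J (
    SetIndex rev (IAdd (IMul (INum 2) (IVar rev))
                       (IMod (IVar rest) (INum 2))) ;;
    SetIndex rest (IDiv (IVar rest) (INum 2))).

(* (a, b) |-> (a + w b, a - w b), w = exp (2 pi i k / (2 half)) *)
Definition butterfly : prog :=
  SetIndex top (IAdd (IMul (IVar block) (IMul (INum 2) (IVar half)))
                     (IVar k)) ;;
  Root W (IMul (INum 2) (IVar half))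
         (ISub (IMul (INum 2) (IVar half)) (IVar k)) ;;
  Arith OpMul V W (A (IAdd (IVar top) (IVar half))) ;;
  Arith OpSub (A (IAdd (IVar top) (IVar half))) (A (IVar top)) V ;;
  Arith OpAdd (A (IVar top)) (A (IVar top)) V.

Definition radix2_ifft : prog :=
  For k (IExp (INum 2) J) (
    bit_reversal ;;
    Fetch (A (IVar rev)) (IVar k)) ;;
  For stage J (
    SetIndex half (IExp (INum 2) (IVar stage)) ;;
    For block (IExp (INum 2) (ISub (ISub J (IVar stage)) (INum 1))) (
      For k (IVar half) butterfly)) ;;
  Const W (IExp (INum 2) J) ;;
  For k (IExp (INum 2) J) (Arith OpDiv (A (IVar k)) (A (IVar k)) W).

End Radix2.

(** * Complexity bounds *)

Definition log2 (R : realType) (t : R) : R := ln t / ln 2.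

(* In O-estimates in several variables a logarithmic factor below 1 has to be
   read as 1: with plain logarithms, m log m log (N / m) is 0 at m = 1, and
   m log (N / m) stays bounded at m = N - 1, so that no algorithm could meet
   the bounds.  For 2 <= m <= N / 2 both readings agree. *)
Definition log2_factor (R : realType) (t : R) : R := Num.max 1 (log2 t).

(* Main.v *)
Require Import Defs.
From mathcomp Require Import all_boot all_order all_algebra.
From mathcomp Require Import complex.
From mathcomp Require Import reals exp trigo.
From mathcomp Require Import zify ring lra.

Set Implicit Arguments.
Unset Strict Implicit.
Unset Printing Implicit Defensive.

Import Order.TTheory GRing.Theory Num.Theory.
Local Open Scope ring_scope.
Local Open Scope complex_scope.

(** The transform of the periodization of [x] with period [2 ^ j] consists of the
    samples of index divisible by [2 ^ (J - j)].  The algorithm computes these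
    periodizations for [j = 0, 1, ..., J], the last one being [x].  As [x] is
    non-negative, no entries cancel, so that the support of a periodization is
    the reduction of the support of [x] and tells where the entries of the next
    one can be.

    Suppose that the support at level [j] lies in a cyclic interval of length
    [2 ^ l].  The entries [k] and [k + 2 ^ j] at level [j.+1] have a known sum;
    their difference is needed only for the [2 ^ l] indices [k] of the
    interval.  An inverse transform of length [2 ^ l], applied to samples at
    [2 ^ l] odd frequencies, adds up the entries of [x], weighted with roots of
    unity, over classes modulo [2 ^ l] (lemma [aliasing]).  Reduction modulo
    [2 ^ l] is injective on the interval, hence each class meets the support at
    level [j] at most once and yields the wanted difference
    ([alternating_samples]).  One level thus costs [O (2 ^ l * (l + 1))] operations
    and [2 ^ l] samples ([refine_spec]).

    If [2 ^ e] is the least power of two that is at least the support length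
    [m], then the exponent found at level [j] is at most [minn j e].  The levels
    below [e] cost as much as a geometric series, and the [J - e] others cost
    [O (m (1 + log m))] each, where [J - e] is about [log2 (N / m)] ([sum_levels],
    [level_bounds]).  The program [detect] stops one level early: there, an
    interval longer than [N / 4] triggers the radix-2 transform, which is then
    as cheap as a few levels since [J <= e.+1]; otherwise [refine] takes the
    last step.  An interval of length at most [N / 4] at that level gives
    [m <= 3 N / 4], and [m <= N / 4] gives such an interval, whence the two
    thresholds.

    The radix-2 program satisfies the loop invariant that, after stage [s], the
    array holds the transforms of length [2 ^ s] of the decimated inputs in
    bit-reversed order ([partial_dft_step], [ifft_stages_spec]).  The same
    proof covers the short transforms, which are the same program with other
    arrays and addresses. *)

Local Notation memory := Defs.mem.
Local Notation "p ;; q" := (Then p q) (at level 60, right associativity).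

(** * Roots of unity *)

Lemma unit_circle_exp (R : realType) (t : R) n :
  (cos t -i* sin t) ^+ n = cos (t *+ n) -i* sin (t *+ n) :> R[i].
Proof.
elim: n => [|n IH]; first by rewrite expr0 !mulr0n cos0 sin0 oppr0.
rewrite exprS IH mulrS cosD sinD; simpc.
by congr Complex; ring.
Qed.

Lemma omega_mul (R : realType) c n : (0 < c)%N ->
  omega R (c * n) ^+ c = omega R n.
Proof.
move=> c0; rewrite /omega unit_circle_exp.
have -> // : (2 * pi / (c * n)%:R : R) *+ c = 2 * pi / n%:R.
rewrite -[_ *+ c]mulr_natr natrM invfM [c%:R^-1 * _]mulrC !mulrA mulfVK //.
by rewrite pnatr_eq0 -lt0n.
Qed.

Lemma omega1 (R : realType) : omega R 1 = 1.
Proof. by rewrite /omega divr1 mulr_natl cos2pi sin2pi oppr0. Qed.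

Lemma omega2 (R : realType) : omega R 2 = -1.
Proof.
by rewrite /omega mulrAC divff ?mul1r ?cospi ?sinpi ?oppr0 ?pnatr_eq0 //; simpc.
Qed.

Lemma omega_expn (R : realType) n : (0 < n)%N -> omega R n ^+ n = 1.
Proof. by move=> n0; rewrite -[in omega R n](muln1 n) omega_mul ?omega1. Qed.

Lemma omega_half (R : realType) n : (0 < n)%N -> omega R (2 * n) ^+ n = -1.
Proof. by move=> n0; rewrite mulnC omega_mul ?omega2. Qed.

Lemma omega_neq0 (R : realType) n : (0 < n)%N -> omega R n != 0.
Proof.
move=> n0; apply/eqP => w0; have := @omega_expn R n n0.
by rewrite w0 expr0n -[n]prednK //= => /eqP; rewrite eq_sym oner_eq0.
Qed.

Lemma omega_exp_sub (R : realType) n k : (0 < n)%N -> (k <= n)%N ->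
  omega R n ^+ (n - k) = omega R n ^- k.
Proof.
move=> n0 kn; rewrite expfB_cond; first by rewrite omega_expn ?mul1r.
by rewrite (negPf (omega_neq0 R n0)).
Qed.

(** An order of [omega R (2 ^ n)] below [2 ^ n] would divide [2 ^ n.-1], where
    the power is [-1]. *)
Lemma omega_prim (R : realType) n : (2 ^ n).-primitive_root (omega R (2 ^ n)).
Proof.
have n0 : (0 < 2 ^ n)%N by rewrite expn_gt0.
have [m prm /(dvdn_pfactor _ _ (isT : prime 2))[e en em]] :=
  prim_order_exists n0 (@omega_expn R _ n0).
case: (ltngtP e n) en => // [lt_en _|e_n _]; last by rewrite em e_n in prm.
have n_gt0 : (0 < n)%N by exact: leq_ltn_trans (leq0n e) lt_en.
have : omega R (2 ^ n) ^+ (2 ^ n.-1) = 1.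
  apply/eqP; rewrite -(prim_order_dvd prm) em; apply: dvdn_exp2l.
  by rewrite -ltnS prednK.
rewrite -[in omega _ _](prednK n_gt0) expnS omega_half ?expn_gt0 // => /eqP.
by rewrite eq_sym -subr_eq0 opprK -(natrD _ 1 1) pnatr_eq0.
Qed.

(** Geometric sum of the root of unity [omega ^+ i / omega ^+ t], which is 1
    exactly if [i = t] modulo [2 ^ n]. *)
Lemma omega_orthogonal (R : realType) n i t :
  \sum_(q < 2 ^ n) omega R (2 ^ n) ^+ (i * q) * omega R (2 ^ n) ^- (t * q) =
  if (i == t %[mod 2 ^ n])%N then (2 ^ n)%:R else 0.
Proof.
set w := omega R (2 ^ n).
have w0 : w != 0 by rewrite omega_neq0 ?expn_gt0.
have -> : \sum_(q < 2 ^ n) w ^+ (i * q) * w ^- (t * q) =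
          \sum_(q < 2 ^ n) (w ^+ i / w ^+ t) ^+ q.
  by apply: eq_bigr => q _; rewrite exprMn exprVn -!exprM.
have -> : (i == t %[mod 2 ^ n])%N = (w ^+ i / w ^+ t == 1).
  rewrite -(eq_prim_root_expr (omega_prim R n)) -/w.
  by rewrite -[RHS](inj_eq (mulIf (expf_neq0 t w0))) mulfVK ?expf_neq0 ?mul1r.
case: eqP => [-> | /eqP z1].
  under eq_bigr do rewrite expr1n.
  by rewrite sumr_const card_ord.
have : (w ^+ i / w ^+ t) ^+ (2 ^ n) - 1 = 0.
  rewrite exprMn exprVn -!exprM ![(_ * 2 ^ n)%N]mulnC !exprM.
  by rewrite omega_expn ?expn_gt0 // !expr1n divr1 subrr.
rewrite subrX1 => /eqP; rewrite mulf_eq0 subr_eq0 (negPf z1) /=.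
by move/eqP.
Qed.

(** * Bit reversal and decimation in time *)

Fixpoint brev n k : nat :=
  if n is n'.+1 then (2 * brev n' k + (k %/ 2 ^ n') %% 2)%N else 0%N.

Lemma brev_lt n k : (brev n k < 2 ^ n)%N.
Proof.
elim: n => //= n IH; rewrite expnS.
have := ltn_pmod (k %/ 2 ^ n) (isT : 0 < 2)%N; lia.
Qed.

Lemma brev_mod n q k : brev n (q * 2 ^ n + k) = brev n k.
Proof.
suff gen d : brev n (q * 2 ^ (d + n) + k) = brev n k by rewrite (gen 0%N).
elim: n d => //= n IH d; rewrite addnS -addSn IH; congr (_ + _)%N.
rewrite expnD mulnA divnMDl ?expn_gt0 // expnS mulnCA -modnDml.
by rewrite modnMr add0n.
Qed.

(** The definition splits off the highest bit of the argument, this lemma the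
    lowest one; together they show that reversal is an involution. *)
Lemma brev_double n b e : (e < 2)%N ->
  brev n.+1 (2 * b + e) = (e * 2 ^ n + brev n b)%N.
Proof.
move=> e2; elim: n => [|n IH].
  by rewrite /= divn1 expn0; lia.
rewrite [LHS]/= -/(brev n.+1 _) IH [brev n.+1 b]/=.
have -> : ((2 * b + e) %/ 2 ^ n.+1 = b %/ 2 ^ n)%N.
  by rewrite expnS divnMA [(2 * b)%N]mulnC divnMDl // (divn_small e2) addn0.
by rewrite expnS; lia.
Qed.

Lemma brevK n k : (k < 2 ^ n)%N -> brev n (brev n k) = k.
Proof.
elim: n k => [|n IH] k; first by rewrite expn0; case: k.
rewrite expnS => k_lt; have e2 := ltn_pmod k (isT : 0 < 2)%N.
have b_lt : (k %/ 2 < 2 ^ n)%N by rewrite ltn_divLR // mulnC.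
rewrite [in brev n.+1 k](divn_eq k 2) [(_ * 2)%N]mulnC brev_double //=.
rewrite brev_mod IH // divnMDl ?expn_gt0 // (divn_small (brev_lt _ _)) addn0.
by rewrite modn_mod [RHS](divn_eq k 2) mulnC.
Qed.

Lemma sum_even_odd (V : zmodType) (F : nat -> V) h :
  \sum_(q < 2 * h) F q = \sum_(q < h) (F (2 * q)%N + F (2 * q + 1)%N).
Proof.
elim: h => [|h IH]; first by rewrite muln0 !big_ord0.
by rewrite mulnS add2n !big_ord_recr /= IH addn1 addrA.
Qed.

(** The inverse transform, without its factor [2 ^ - s], of the subsequence of
    [y] with step [2 ^ (n - s)] that starts at the bit reversal of [c]. *)
Definition partial_dft (R : realType) n (y : nat -> R[i]) s c r : R[i] :=
  \sum_(q < 2 ^ s)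
    y (q * 2 ^ (n - s) + brev (n - s) c)%N * omega R (2 ^ s) ^- (q * r).

Lemma partial_dft_shift (R : realType) n (y : nat -> R[i]) s c r :
  partial_dft n y s c (2 ^ s + r) = partial_dft n y s c r.
Proof.
apply: eq_bigr => q _; congr (_ * _^-1).
by rewrite mulnDr exprD mulnC exprM omega_expn ?expn_gt0 // expr1n mul1r.
Qed.

(** Even and odd indices [q] contribute the transforms of the two interleaved
    halves of the subsequence, whose starting points differ in the lowest bit
    of [c]. *)
Lemma partial_dft_step (R : realType) n (y : nat -> R[i]) s c r : (s < n)%N ->
  partial_dft n y s.+1 c r =
  partial_dft n y s (2 * c) r +
  omega R (2 ^ s.+1) ^- r * partial_dft n y s (2 * c + 1) r.
Proof.
move=> s_lt; rewrite /partial_dft expnS.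
rewrite (sum_even_odd (fun q =>
  y (q * 2 ^ (n - s.+1) + brev (n - s.+1) c)%N * omega R (2 * 2 ^ s) ^- (q * r))).
rewrite big_split /= mulr_sumr.
have nsE : (n - s)%N = (n - s.+1).+1 by rewrite -subSn.
congr (_ + _); apply: eq_bigr => q _.
  rewrite -[in brev (n - s) _](addn0 (2 * c)%N) nsE brev_double // mul0n add0n expnS.
  rewrite -[(2 * q * r)%N]mulnA [omega _ _ ^+ _]exprM omega_mul //.
  by rewrite mulnA [(2 * q)%N]mulnC.
rewrite nsE brev_double // mul1n expnS [RHS]mulrC -mulrA; congr (_ * _).
  by congr y; lia.
rewrite -invfM; congr (_^-1).
rewrite mulnDl mul1n exprD -[(2 * q * r)%N]mulnA [omega _ _ ^+ _]exprM.
by rewrite omega_mul.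
Qed.

(** * Programs and their frames *)


(** The part of a specification that composes by itself: only the arrays in
    [arrs] and the registers in [vars] may change from [s] to [t], at the exact
    costs [f] and [q]. *)
Definition frame (R : realType) (arrs vars : seq nat) (f q : nat)
    (s t : state R) : Prop :=
  [/\ forall a p, a \notin arrs -> memory t a p = memory s a p,
      forall v, v \notin vars -> regs t v = regs s v,
      flops t = (flops s + f)%N & samples t = (samples s + q)%N].

Lemma frame_refl (R : realType) arrs vars (s : state R) :
  frame arrs vars 0 0 s s.
Proof. by split; rewrite ?addn0. Qed.

Lemma frame_trans (R : realType) arrs vars f q f' q' (s t u : state R) :
  frame arrs vars f q s t -> frame arrs vars f' q' t u ->
  frame arrs vars (f + f') (q + q') s u.
Proof.
move=> [m1 r1 f1 q1] [m2 r2 f2 q2]; split.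
- by move=> a p ha; rewrite m2 ?m1.
- by move=> v hv; rewrite r2 ?r1.
- by rewrite f2 f1 addnA.
- by rewrite q2 q1 addnA.
Qed.

Lemma frame_sub (R : realType) arrs vars arrs' vars' f q (s t : state R) :
  {subset arrs <= arrs'} -> {subset vars <= vars'} ->
  frame arrs vars f q s t -> frame arrs' vars' f q s t.
Proof.
move=> sa sv [m1 r1 f1 q1]; split => // [a p|v] h.
  by apply: m1; apply: contra h; apply: sa.
by apply: r1; apply: contra h; apply: sv.
Qed.

Lemma frame_set_reg (R : realType) arrs vars (s : state R) v n :
  v \in vars -> frame arrs vars 0 0 s (set_reg s v n).
Proof.
move=> hv; split; rewrite /= ?addn0 // => w hw.
by case: eqP => // wv; rewrite wv hv in hw.
Qed.

(** The Hoare rule of loops; [I i] is the invariant before pass [i]. *)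
Lemma run_for (R : realType) N (xh : 'cV[R[i]]_N) v e p
    (I : nat -> state R -> Prop) s :
  I 0%N s ->
  (forall i t, (i < ieval (regs s) e)%N -> I i t ->
     I i.+1 (run xh p (set_reg t v i))) ->
  I (ieval (regs s) e) (run xh (For v e p) s).
Proof.
move=> I0 IS /=; move: (ieval (regs s) e) IS => n.
elim: n => // n IH IS.
rewrite -addn1 iotaD foldl_cat /= add0n addn1; apply: (IS n) => //.
by apply: IH => i t lt_i; apply: IS; apply: ltnW.
Qed.

(** The same rule for bodies with a frame whose costs do not depend on the
    pass. *)
Lemma frame_for (R : realType) N (xh : 'cV[R[i]]_N) v e p arrs vars f q
    (I : nat -> state R -> Prop) s n :
  ieval (regs s) e = n -> I 0%N s ->
  (forall i t, (i < n)%N -> frame arrs vars (i * f) (i * q) s t -> I i t ->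
     let t' := set_reg t v i in
     frame arrs vars f q t' (run xh p t') /\ I i.+1 (run xh p t')) ->
  v \in vars ->
  frame arrs vars (n * f) (n * q) s (run xh (For v e p) s) /\
  I n (run xh (For v e p) s).
Proof.
move=> <- I0 IS hv.
apply: (run_for (I := fun i t => frame arrs vars (i * f) (i * q) s t /\ I i t)).
  by split => //; apply: frame_refl.
move=> i t lt_i [Ft It]; have [Ft' It'] := IS i t lt_i Ft It; split => //.
rewrite !mulSnr; apply: frame_trans Ft _.
by rewrite -[f]add0n -[q]add0n; apply: frame_trans Ft'; apply: frame_set_reg.
Qed.

(** * The inverse fast Fourier transform as a program *)

Definition bit_reverse (n : nat) : prog :=
  SetIndex 3 (INum 0) ;;
  SetIndex 4 (IVar 1) ;;
  For 2 (IVar n) (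
    SetIndex 3 (IAdd (IMul (INum 2) (IVar 3)) (IMod (IVar 4) (INum 2))) ;;
    SetIndex 4 (IDiv (IVar 4) (INum 2))).

Definition butterfly_in (a : nat) : prog :=
  SetIndex 7 (IAdd (IMul (IVar 6) (IMul (INum 2) (IVar 8))) (IVar 1)) ;;
  Root (Cell 1 (INum 0)) (IMul (INum 2) (IVar 8))
       (ISub (IMul (INum 2) (IVar 8)) (IVar 1)) ;;
  Arith OpMul (Cell 1 (INum 1)) (Cell 1 (INum 0))
        (Cell a (IAdd (IVar 7) (IVar 8))) ;;
  Arith OpSub (Cell a (IAdd (IVar 7) (IVar 8))) (Cell a (IVar 7))
        (Cell 1 (INum 1)) ;;
  Arith OpAdd (Cell a (IVar 7)) (Cell a (IVar 7)) (Cell 1 (INum 1)).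

Definition butterflies (a : nat) (blocks : iexp) : prog :=
  For 6 blocks (For 1 (IVar 8) (butterfly_in a)).

(** [radix2_ifft] with the array [a], the register [n] that holds the
    logarithm of the length, and the addresses [f] of the samples as
    parameters. *)
Definition ifft (a n : nat) (f : iexp) : prog :=
  For 1 (IExp (INum 2) (IVar n)) (
    bit_reverse n ;;
    Fetch (Cell a (IVar 3)) f) ;;
  For 5 (IVar n) (
    SetIndex 8 (IExp (INum 2) (IVar 5)) ;;
    butterflies a (IExp (INum 2) (ISub (ISub (IVar n) (IVar 5)) (INum 1)))) ;;
  Const (Cell 1 (INum 0)) (IExp (INum 2) (IVar n)) ;;
  For 1 (IExp (INum 2) (IVar n))
    (Arith OpDiv (Cell a (IVar 1)) (Cell a (IVar 1)) (Cell 1 (INum 0))).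

Lemma radix2_ifftE : radix2_ifft = ifft 0 0 (IVar 1).
Proof. by []. Qed.

Lemma bit_reverse_spec (R : realType) N (xh : 'cV[R[i]]_N) n (s : state R) :
  n \notin [:: 2; 3; 4]%N ->
  let t := run xh (bit_reverse n) s in
  frame [::] [:: 2; 3; 4]%N 0 0 s t /\
  regs t 3 = brev (regs s n) (regs s 1).
Proof.
move=> hn t; pose s1 := run xh (SetIndex 3 (INum 0) ;; SetIndex 4 (IVar 1)) s.
have nE : ieval (regs s1) (IVar n) = regs s n.
  by rewrite /= ; move: hn; rewrite !inE !negb_or => /and3P[_ /negPf-> /negPf->].
have F1 : frame [::] [:: 2; 3; 4]%N 0 0 s s1.
  by apply: (@frame_trans _ _ _ 0 0 0 0); [|]; apply: frame_set_reg.
pose I i (u : state R) :=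
  regs u 3 = brev i (regs s 1) /\ regs u 4 = (regs s 1 %/ 2 ^ i)%N.
pose body := SetIndex 3 (IAdd (IMul (INum 2) (IVar 3)) (IMod (IVar 4) (INum 2)))
  ;; SetIndex 4 (IDiv (IVar 4) (INum 2)).
have I0 : I 0%N s1 by rewrite /I /= divn1.
have IS i u : (i < regs s n)%N ->
    frame [::] [:: 2; 3; 4]%N (i * 0) (i * 0) s1 u -> I i u ->
    let u' := set_reg u 2 i in
    frame [::] [:: 2; 3; 4]%N 0 0 u' (run xh body u') /\ I i.+1 (run xh body u').
  move=> _ _ [r3 r4] /=; split; last first.
    by rewrite /I /= r3 r4 expnSr divnMA.
  by apply: (@frame_trans _ _ _ 0 0 0 0 _ (set_reg _ _ _)); apply: frame_set_reg.
have [F2 [r3 _]] := frame_for nE I0 IS isT.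
by split => //; rewrite !muln0 in F2; exact: (frame_trans F1 F2).
Qed.

Lemma butterfly_spec (R : realType) N (xh : 'cV[R[i]]_N) a (s : state R) :
  a != 1%N -> (0 < regs s 8)%N -> (regs s 1 <= 2 * regs s 8)%N ->
  let h := regs s 8 in
  let top := (regs s 6 * (2 * h) + regs s 1)%N in
  let z := omega R (2 * h) ^- regs s 1 * memory s a (top + h)%N in
  let t := run xh (butterfly_in a) s in
  frame [:: a; 1%N] [:: 7%N] 4 0 s t /\
  forall p, memory t a p =
    if p == top then memory s a top + z
    else if p == (top + h)%N then memory s a top - z else memory s a p.
Proof.
move=> a1 h0 kh /=; set h := regs s 8; set top := (_ * _ + _)%N.
have a1' : (1 == a)%N = false by rewrite eq_sym (negPf a1).
have ht : (top == top + h)%N = false.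
  rewrite -{1}[top]addn0. rewrite eqn_add2l. by rewrite ltn_eqF.
have th : (top + h == top)%N = false by rewrite eq_sym.
split; [split|].
- move=> b p; rewrite !inE negb_or /= => /andP[/negPf -> /negPf ->].
  by [].
- by move=> v; rewrite !inE /= => /negPf ->.
- by rewrite /= !addnS addn0.
- by rewrite /= addn0.
move=> p; rewrite /= -/h -/top (negPf a1) a1' !eqxx /= ht ?th /=.
by rewrite omega_exp_sub ?muln_gt0.
Qed.

Lemma mulnD_eq h c r c' r' : (r < h)%N -> (r' < h)%N ->
  (c * h + r == c' * h + r')%N = (c == c') && (r == r').
Proof.
move=> rh rh'; apply/eqP/andP => [e|[/eqP-> /eqP->]//].
have h0 : (0 < h)%N by apply: leq_ltn_trans rh.
have ec : c = c'.
  have := congr1 (divn^~ h) e.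
  by rewrite !divnMDl // !divn_small // !addn0.
by move: e; rewrite ec => /addnI->.
Qed.

(** Blocks are pairs of neighbouring rows, of length [h], of the array.  The
    loop invariant lists the pairs of entries already combined: they are the
    pairs that precede the current pair lexicographically. *)
Lemma butterflies_spec (R : realType) N (xh : 'cV[R[i]]_N) a blocks
    (s : state R) :
  a != 1%N -> (0 < regs s 8)%N ->
  let h := regs s 8 in
  let n := ieval (regs s) blocks in
  let t := run xh (butterflies a blocks) s in
  frame [:: a; 1%N] [:: 1; 6; 7]%N (n * (h * 4)) 0 s t /\
  forall c r, (c < n)%N -> (r < h)%N ->
    let u := memory s a (2 * c * h + r)%N in
    let z := omega R (2 * h) ^- r * memory s a ((2 * c + 1) * h + r)%N in
    memory t a (2 * c * h + r)%N = u + z /\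
    memory t a ((2 * c + 1) * h + r)%N = u - z.
Proof.
move=> a1 h0 h n t.
pose I (d : nat -> nat -> bool) (t' : state R) := forall c r, (r < h)%N ->
  let u := memory s a (2 * c * h + r)%N in
  let v := memory s a ((2 * c + 1) * h + r)%N in
  let z := omega R (2 * h) ^- r * v in
  memory t' a (2 * c * h + r)%N = (if d c r then u + z else u) /\
  memory t' a ((2 * c + 1) * h + r)%N = if d c r then u - z else v.
pose Io b := I (fun c _ => c < b)%N.
pose Ii b k := I (fun c r => (c < b) || ((c == b) && (r < k)))%N.
have I0 : Io 0%N s by [].
have IS b t1 : (b < n)%N ->
    frame [:: a; 1%N] [:: 1; 6; 7]%N (b * (h * 4)) (b * 0) s t1 -> Io b t1 ->
    let t2 := set_reg t1 6 b in
    let t3 := run xh (For 1 (IVar 8) (butterfly_in a)) t2 in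
    frame [:: a; 1%N] [:: 1; 6; 7]%N (h * 4) 0 t2 t3 /\ Io b.+1 t3.
  move=> _ F1 H1 t2.
  have h2 : ieval (regs t2) (IVar 8) = h by rewrite /=; case: F1 => _ ->.
  have J0 : Ii b 0%N t2.
    by move=> c r rh; have := H1 c r rh; rewrite /= ltn0 andbF orbF.
  have JS k t3 : (k < h)%N ->
      frame [:: a; 1%N] [:: 1; 7]%N (k * 4) (k * 0) t2 t3 -> Ii b k t3 ->
      let t4 := set_reg t3 1 k in
      let t5 := run xh (butterfly_in a) t4 in
      frame [:: a; 1%N] [:: 1; 7]%N 4 0 t4 t5 /\ Ii b k.+1 t5.
    move=> kh F3 H3 t4.
    have r8 : regs t4 8 = h by rewrite /=; case: F3 => _ /= -> //=; case: F1 => _ ->.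
    have r6 : regs t4 6 = b by rewrite /=; case: F3 => _ /= ->.
    have r1 : regs t4 1 = k by [].
    have [||F5 m5] := @butterfly_spec R N xh a t4 a1.
    - by rewrite r8.
    - by rewrite r8 r1; lia.
    split.
      by apply: frame_sub F5 => // v; rewrite !inE => ->; rewrite !orbT.
    rewrite r8 r6 r1 in m5.
    move=> c r rh u v z; rewrite !m5 /u /z /v /=.
    have topE : (b * (2 * h) + k = 2 * b * h + k)%N by lia.
    have botE : (2 * b * h + k + h = (2 * b + 1) * h + k)%N by lia.
    rewrite topE botE !mulnD_eq // !eqn_add2r.
    have -> : ((2 * c == 2 * b + 1) = false)%N by apply/eqP; lia.
    have -> : ((2 * c + 1 == 2 * b) = false)%N by apply/eqP; lia.
    rewrite !eqn_mul2l /=.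
    have [->|nc] /= := eqVneq c b; last by have := H3 c r rh; rewrite /= (negPf nc).
    have [->|nr] /= := eqVneq r k; last first.
      by rewrite ltnS [(r <= k)%N]leq_eqVlt (negPf nr); have := H3 b r rh; rewrite /= eqxx.
    have [] := H3 b k kh; rewrite /= eqxx !ltnn /= => -> ->.
    by rewrite ltnSn.
  have [F3 H3] := frame_for h2 J0 JS isT; rewrite muln0 in F3; split => [|c r rh].
    by apply: frame_sub F3 => // v; rewrite !inE => /orP[] ->; rewrite ?orbT.
  have := H3 c r rh; rewrite /= rh andbT.
  by have -> : ((c < b) || (c == b) = (c < b.+1))%N by rewrite ltnS [RHS]leq_eqVlt orbC.
have [F H] := frame_for (erefl n) I0 IS isT.
split; first by rewrite muln0 in F.
by move=> c r cn rh; have := H c r rh; rewrite /= cn.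
Qed.

Definition ifft_cost n := (n * (2 ^ n.-1 * 4) + 1 + 2 ^ n)%N.

(** Sample [k] goes to the reversal of [k].  As reversal is an involution, each
    cell [p] is written once, with the sample of index [brev n p]. *)
Lemma ifft_load_spec (R : realType) N (xh : 'cV[R[i]]_N) (a n : nat) f
    (g : nat -> nat) (s : state R) :
  n \notin iota 1 8 ->
  (forall r, (forall v, v \notin iota 1 8 -> r v = regs s v) ->
     ieval r f = g (r 1%N)) ->
  let L := (2 ^ regs s n)%N in
  let t := run xh (For 1 (IExp (INum 2) (IVar n))
                     (bit_reverse n ;; Fetch (Cell a (IVar 3)) f)) s in
  frame [:: a; 1%N] (iota 1 8) 0 L s t /\
  forall p, (p < L)%N -> memory t a p = sample xh (g (brev (regs s n) p)).
Proof.
move=> hn hf L t; set m := regs s n.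
pose I k (u : state R) := forall p, (p < L)%N -> (brev m p < k)%N ->
  memory u a p = sample xh (g (brev m p)).
have LE : ieval (regs s) (IExp (INum 2) (IVar n)) = L by [].
have I0 : I 0%N s by [].
have IS k u : (k < L)%N ->
    frame [:: a; 1%N] (iota 1 8) (k * 0) (k * 1) s u -> I k u ->
    let u' := set_reg u 1 k in
    let u2 := run xh (bit_reverse n ;; Fetch (Cell a (IVar 3)) f) u' in
    frame [:: a; 1%N] (iota 1 8) 0 1 u' u2 /\ I k.+1 u2.
  move=> kL Fu Iu u'.
  have hn' : n \notin [:: 2; 3; 4]%N.
    by apply: contra hn; rewrite !inE => /or3P[] ->; rewrite ?orbT.
  have [F1 r3] := bit_reverse_spec xh u' hn'.
  have u'r v : v \notin iota 1 8 -> regs u' v = regs s v.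
    move=> hv; case: Fu => _ rs _ _; rewrite /= rs //.
    by move: hv; rewrite !inE negb_or => /andP[/negPf->].
  have u'n : regs u' n = m by rewrite u'r.
  rewrite u'n [regs u' 1]/= in r3.
  set u1 := run xh (bit_reverse n) u' in F1 r3.
  have fE : ieval (regs u1) f = g k.
    rewrite hf.
      by case: F1 => _ ->.
    have [_ rs _ _] := F1; move=> v hv; rewrite rs ?u'r //.
    by apply: contra hv; rewrite !inE => /or3P[] ->; rewrite ?orbT.
  split.
    rewrite -[0%N]addn0 -[1%N]add0n; apply: (@frame_trans _ _ _ _ _ _ _ _ u1).
      by apply: frame_sub F1 => // v; rewrite !inE => /or3P[] ->; rewrite ?orbT.
    split=> [b p|||] //=; rewrite -/u1 ?addn0 ?addn1 //.
    by rewrite !inE negb_or => /andP[/negPf -> _].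
  move=> p pL; rewrite /= -/u1 r3 fE eqxx /= ltnS.
  have [-> _|pk] := eqVneq p (brev m k); first by rewrite brevK.
  rewrite leq_eqVlt => /orP[/eqP bk|bk]; first by rewrite -bk brevK ?eqxx in pk.
  by have [ms _ _ _] := F1; rewrite ms //; apply: Iu.
have [F H] := frame_for LE I0 IS isT.
rewrite muln0 muln1 in F; split => // p pL.
by apply: H => //; apply: brev_lt.
Qed.

(** Before stage [st], row [c] of length [2 ^ st] holds [partial_dft m y st c]:
    bit reversal provides this for [st = 0], and the only row for [st = m] is
    the full transform. *)
Lemma ifft_stages_spec (R : realType) N (xh : 'cV[R[i]]_N) (a n : nat)
    (y : nat -> R[i]) (s : state R) :
  a != 1%N -> n \notin iota 1 8 ->
  (forall p, (p < 2 ^ regs s n)%N -> memory s a p = y (brev (regs s n) p)) ->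
  let t := run xh (For 5 (IVar n) (
    SetIndex 8 (IExp (INum 2) (IVar 5)) ;;
    butterflies a (IExp (INum 2) (ISub (ISub (IVar n) (IVar 5)) (INum 1))))) s in
  frame [:: a; 1%N] (iota 1 8) (regs s n * (2 ^ (regs s n).-1 * 4)) 0 s t /\
  forall p, (p < 2 ^ regs s n)%N ->
    memory t a p = \sum_(q < 2 ^ regs s n) y q * omega R (2 ^ regs s n) ^- (q * p).
Proof.
move=> a1 hn hy t; set m := regs s n.
pose I st (u : state R) := forall c r, (c < 2 ^ (m - st))%N -> (r < 2 ^ st)%N ->
  memory u a (c * 2 ^ st + r)%N = partial_dft m y st c r.
have nE : ieval (regs s) (IVar n) = m by [].
have I0 : I 0%N s.
  move=> c r; rewrite expn0 subn0 ltnS leqn0 muln1 => cm /eqP ->.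
  rewrite addn0 /partial_dft expn0 big_ord1 !mul0n expr0 invr1 mulr1 subn0.
  by rewrite hy.
have IS st u : (st < m)%N ->
    frame [:: a; 1%N] (iota 1 8) (st * (2 ^ m.-1 * 4)) (st * 0) s u -> I st u ->
    let u' := set_reg u 5 st in
    let u2 := run xh (SetIndex 8 (IExp (INum 2) (IVar 5)) ;;
      butterflies a (IExp (INum 2) (ISub (ISub (IVar n) (IVar 5)) (INum 1)))) u' in
    frame [:: a; 1%N] (iota 1 8) (2 ^ m.-1 * 4) 0 u' u2 /\ I st.+1 u2.
  move=> stm Fu Iu u' u2.
  pose u1 := set_reg u' 8 (2 ^ st).
  have h8 : (regs u1 8 = 2 ^ st)%N by [].
  have u1n : regs u1 n = m.
    case: Fu => _ rs _ _; rewrite /= rs //.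
    by move: hn; rewrite !inE !negb_or; do 4 case/andP=> _; case/and4P=> /negPf-> _ _ /negPf->.
  have [|F2 H2] := butterflies_spec xh
    (IExp (INum 2) (ISub (ISub (IVar n) (IVar 5)) (INum 1))) (s := u1) a1.
    by rewrite h8 expn_gt0.
  have nbE : ieval (regs u1)
      (IExp (INum 2) (ISub (ISub (IVar n) (IVar 5)) (INum 1))) =
      (2 ^ (m - st.+1))%N.
    by rewrite [LHS]/= -[X in (X - _ - _)%N]/(regs u1 n) u1n -subnDA addn1.
  rewrite nbE h8 -/u2 in F2 H2.
  split.
    have costE : (2 ^ (m - st.+1) * (2 ^ st * 4) = 2 ^ m.-1 * 4)%N.
      by rewrite mulnA -expnD; congr (2 ^ _ * 4)%N; lia.
    rewrite -costE -[X in frame _ _ X]add0n -[X in frame _ _ _ X]add0n.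
    apply: (@frame_trans _ _ _ _ _ _ _ _ u1); first exact: frame_set_reg.
    by apply: frame_sub F2 => // v; rewrite !inE => /or3P[] ->; rewrite ?orbT.
  have half c r : (c < 2 ^ (m - st.+1))%N -> (r < 2 ^ st)%N ->
      memory u2 a (2 * c * 2 ^ st + r)%N = partial_dft m y st.+1 c r /\
      memory u2 a ((2 * c + 1) * 2 ^ st + r)%N =
        partial_dft m y st.+1 c (2 ^ st + r)%N.
    move=> cm rs; have [-> ->] := H2 c r cm rs.
    have mst : (2 ^ (m - st) = 2 * 2 ^ (m - st.+1))%N by rewrite -expnS -subSn.
    rewrite !(partial_dft_step _ _ _ stm) !partial_dft_shift.
    rewrite [memory u1 _ _]Iu ?mst; [|lia|by []].
    rewrite [memory u1 _ _]Iu ?mst; [|lia|by []].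
    rewrite -expnS exprD expnS omega_half ?expn_gt0 // mulN1r invrN mulNr.
    by [].
  move=> c r cm; rewrite expnS => rs.
  have [r_lt|r_ge] := ltnP r (2 ^ st).
    by have [<- _] := half c r cm r_lt; congr (memory _ _ _); lia.
  have r_lt : (r - 2 ^ st < 2 ^ st)%N by lia.
  have [_] := half c _ cm r_lt; rewrite subnKC // => <-.
  by congr (memory _ _ _); lia.
have [F H] := frame_for nE I0 IS isT.
rewrite muln0 in F; split => // p pL.
have := H 0%N p; rewrite mul0n add0n => ->; rewrite ?subnn //.
rewrite /partial_dft subnn /=; apply: eq_bigr => q _.
by rewrite expn0 muln1 addn0.
Qed.

Lemma ifft_spec (R : realType) N (xh : 'cV[R[i]]_N) (a n : nat) f
    (g : nat -> nat) (s : state R) :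
  a != 1%N -> n \notin iota 1 8 ->
  (forall r, (forall v, v \notin iota 1 8 -> r v = regs s v) ->
     ieval r f = g (r 1%N)) ->
  let L := (2 ^ regs s n)%N in
  let t := run xh (ifft a n f) s in
  frame [:: a; 1%N] (iota 1 8) (ifft_cost (regs s n)) L s t /\
  forall p, (p < L)%N ->
    memory t a p =
      (\sum_(q < L) sample xh (g q) * omega R L ^- (q * p)) / L%:R.
Proof.
move=> a1 hn hf L t.
have [F1 H1] := ifft_load_spec xh a hn hf.
set s1 := run xh _ s in F1 H1.
have n1 : regs s1 n = regs s n by case: F1 => _ ->.
have [|F2 H2] := @ifft_stages_spec R N xh a n (fun q => sample xh (g q)) s1 a1 hn.
  by move=> p; rewrite n1; apply: H1.
set s2 := run xh _ s1 in F2 H2; rewrite n1 -/L in F2 H2.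
have n2 : regs s2 n = regs s n by case: F2 => _ ->.
pose s3 := run xh (Const (Cell 1 (INum 0)) (IExp (INum 2) (IVar n))) s2.
have n3 : regs s3 n = regs s n by [].
pose I k (u : state R) := memory u 1 0 = L%:R /\ forall p,
  memory u a p = if (p < k)%N then memory s2 a p / L%:R else memory s2 a p.
have LE : ieval (regs s3) (IExp (INum 2) (IVar n)) = L by rewrite /= n2.
have I0 : I 0%N s3.
  by split=> [|p] /=; rewrite ?n2 // (negPf a1).
have IS k u : (k < L)%N ->
    frame [:: a; 1%N] (iota 1 8) (k * 1) (k * 0) s3 u -> I k u ->
    let u' := set_reg u 1 k in
    let u2 := run xh
      (Arith OpDiv (Cell a (IVar 1)) (Cell a (IVar 1)) (Cell 1 (INum 0))) u' in
    frame [:: a; 1%N] (iota 1 8) 1 0 u' u2 /\ I k.+1 u2.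
  move=> kL _ [W Iu] u'.
  split.
    split=> [b p|||] //=; rewrite ?addn0 ?addn1 //.
    by rewrite !inE negb_or => /andP[/negPf -> _].
  split=> [|p]; first by rewrite /= eq_sym (negPf a1).
  rewrite /= eqxx W !Iu /= ltnn.
  have [->|pk] := eqVneq p k; first by rewrite ltnSn.
  by rewrite ltnS [(p <= k)%N]leq_eqVlt (negPf pk).
have [F4 [_ H4]] := frame_for LE I0 IS isT.
split; last by move=> p pL; rewrite -H2 // [LHS]H4 pL.
rewrite muln0 muln1 in F4.
have F3 : frame [:: a; 1%N] (iota 1 8) 1 0 s2 s3.
  split=> [b p|||] //=; rewrite ?addn0 ?addn1 //.
  by rewrite !inE negb_or => /andP[_ /negPf ->].
have := frame_trans (frame_trans (frame_trans F1 F2) F3) F4.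
by rewrite add0n !addn0.
Qed.

(** * Periodizations of the unknown vector *)

Definition periodization (R : realType) J (x : 'cV[R]_(2 ^ J)) j k : R :=
  \sum_(i < 2 ^ J | (i %% 2 ^ j == k)%N) x i 0.

Lemma periodization_ge0 (R : realType) J (x : 'cV[R]_(2 ^ J)) j k :
  nonneg_vec x -> 0 <= periodization x j k.
Proof. by move=> x0; apply: sumr_ge0 => i _; apply: x0. Qed.

(** A sum of non-negative entries vanishes only if all of them do. *)
Lemma periodization_eq0 (R : realType) J (x : 'cV[R]_(2 ^ J)) j (i : 'I_(2 ^ J)) :
  nonneg_vec x -> periodization x j (i %% 2 ^ j)%N = 0 -> x i 0 = 0.
Proof.
move=> x0 /eqP; rewrite psumr_eq0 => [/allP/(_ i)|k _]; last exact: x0.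
by rewrite mem_index_enum eqxx => /(_ isT)/eqP.
Qed.

Lemma periodization_full (R : realType) J (x : 'cV[R]_(2 ^ J)) (i : 'I_(2 ^ J)) :
  periodization x J i = x i 0.
Proof.
rewrite /periodization (eq_bigl (pred1 i)) ?big_pred1_eq // => k.
by rewrite modn_small.
Qed.

Lemma periodization0 (R : realType) J (x : 'cV[R]_(2 ^ J)) :
  periodization x 0 0 = \sum_(i < 2 ^ J) x i 0.
Proof. by apply: eq_bigl => i; rewrite expn0 modn1. Qed.

Lemma modn_double r h k : (r < 2 * h)%N -> (k < h)%N ->
  (r %% h == k)%N = (r == k) || (r == k + h)%N.
Proof.
move=> rh kh; have [r_lt|r_ge] := ltnP r h.
  by rewrite modn_small // [(r == k + h)%N]ltn_eqF ?orbF //; lia.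
rewrite -{1}(subnK r_ge) modnDr modn_small; last by lia.
have -> : (r == k)%N = false by lia.
by rewrite -[in RHS](subnK r_ge) eqn_add2r.
Qed.

Lemma residue_double (i j k : nat) : (k < 2 ^ j)%N ->
  (i %% 2 ^ j == k)%N =
  (i %% 2 ^ j.+1 == k)%N || (i %% 2 ^ j.+1 == k + 2 ^ j)%N.
Proof.
move=> kj; rewrite -(@modn_dvdm (2 ^ j.+1)) ?dvdn_exp2l ?leqnSn //.
by apply: modn_double => //; rewrite -expnS ltn_pmod ?expn_gt0.
Qed.

(** A class modulo [2 ^ j] consists of two classes modulo [2 ^ j.+1]. *)
Lemma sum_residue_split (V : zmodType) n (F : 'I_n -> V) j k : (k < 2 ^ j)%N ->
  \sum_(i < n | (i %% 2 ^ j == k)%N) F i =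
  \sum_(i < n | (i %% 2 ^ j.+1 == k)%N) F i +
  \sum_(i < n | (i %% 2 ^ j.+1 == k + 2 ^ j)%N) F i.
Proof.
move=> kj; have h0 : (0 < 2 ^ j)%N by rewrite expn_gt0.
rewrite (bigID (fun i : 'I_n => (i %% 2 ^ j.+1 == k)%N)) /=.
congr (_ + _); apply: eq_bigl => i; rewrite (residue_double _ kj).
  by rewrite andbC; case: eqP.
by case: eqP => [->|_] //=; [apply/esym/eqP; lia | rewrite andbT].
Qed.

Lemma periodization_split (R : realType) J (x : 'cV[R]_(2 ^ J)) j k :
  (k < 2 ^ j)%N ->
  periodization x j k =
  periodization x j.+1 k + periodization x j.+1 (k + 2 ^ j)%N.
Proof. exact: sum_residue_split. Qed.

Lemma periodization_split_eq0 (R : realType) J (x : 'cV[R]_(2 ^ J)) j k :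
  nonneg_vec x -> (k < 2 ^ j)%N -> periodization x j k = 0 ->
  periodization x j.+1 k = 0 /\ periodization x j.+1 (k + 2 ^ j)%N = 0.
Proof.
move=> x0 kj; rewrite periodization_split // => /eqP.
by rewrite paddr_eq0 ?periodization_ge0 // => /andP[/eqP -> /eqP ->].
Qed.

(** * Cyclic intervals *)

(** The position of [k] relative to the start [mu] on a circle of length [h]. *)
Definition cyc_offset h mu k : nat := ((k + (h - mu)) %% h)%N.

Lemma cyc_offset_lt h mu k : (0 < h)%N -> (cyc_offset h mu k < h)%N.
Proof. exact: ltn_pmod. Qed.

Lemma cyc_offset_eq h mu k l : (mu < h)%N -> (k < h)%N -> (l < h)%N ->
  (cyc_offset h mu k == l) = (k == (mu + l) %% h)%N.
Proof.
move=> mh kh lh; have cancel_mu : (mu + l + (h - mu) = l + h)%N by lia.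
rewrite -[l in LHS](modn_small lh) -(modnDr l) -cancel_mu eqn_modDr.
by rewrite (modn_small kh).
Qed.

(** Reduction modulo a divisor [L] of [h] is injective on an interval of length
    [L]. *)
Lemma cyc_offset_inj h L mu k k' : (L %| h)%N -> (k < h)%N -> (k' < h)%N ->
  (cyc_offset h mu k < L)%N -> (cyc_offset h mu k' < L)%N ->
  (k = k' %[mod L])%N -> k = k'.
Proof.
move=> Lh kh kh' oL oL' kk.
have : (cyc_offset h mu k = cyc_offset h mu k' %[mod L])%N.
  by rewrite !modn_dvdm // -modnDml kk modnDml.
rewrite (modn_small oL) (modn_small oL') => /eqP.
by rewrite eqn_modDr !modn_small // => /eqP.
Qed.

(** * Fourier samples and aliasing *)

Lemma sample_dft (R : realType) N (x : 'cV[R]_N) k : (k < N)%N ->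
  sample (dft x) k = \sum_(i < N) omega R N ^+ (k * i) * (x i 0)%:C.
Proof.
move=> kN; rewrite /sample insubT /= mxE.
by apply: eq_bigr => i _; rewrite !mxE.
Qed.

(** An inverse transform of length [2 ^ l] adds up the entries whose indices
    agree modulo [2 ^ l]; the addresses [g] of the samples may bring in
    weights [c]. *)
Lemma aliasing (R : realType) J (x : 'cV[R]_(2 ^ J)) l (g : nat -> nat)
    (c : nat -> R[i]) t :
  (forall q, (q < 2 ^ l)%N -> (g q < 2 ^ J)%N) ->
  (forall q i, omega R (2 ^ J) ^+ (g q * i) = omega R (2 ^ l) ^+ (i * q) * c i) ->
  (\sum_(q < 2 ^ l) sample (dft x) (g q) * omega R (2 ^ l) ^- (q * t)) /
    (2 ^ l)%:R =
  \sum_(i < 2 ^ J | (i == t %[mod 2 ^ l])%N) c i * (x i 0)%:C.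
Proof.
move=> gJ gc.
have -> : \sum_(q < 2 ^ l) sample (dft x) (g q) * omega R (2 ^ l) ^- (q * t) =
  \sum_(i < 2 ^ J) (\sum_(q < 2 ^ l)
     omega R (2 ^ l) ^+ (i * q) * omega R (2 ^ l) ^- (t * q)) * (c i * (x i 0)%:C).
  under [RHS]eq_bigr do rewrite mulr_suml.
  rewrite exchange_big /=; apply: eq_bigr => q _.
  rewrite sample_dft ?gJ // mulr_suml; apply: eq_bigr => i _.
  by rewrite gc [(q * t)%N]mulnC; ring.
under eq_bigr do rewrite omega_orthogonal.
rewrite mulr_suml [RHS]big_mkcond; apply: eq_bigr => i _.
case: ifP => _; last by rewrite !mul0r.
by rewrite mulrC mulKf // pnatr_eq0 -lt0n expn_gt0.
Qed.

(** The addresses are chosen so that the samples are those of the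
    periodization of length [2 ^ j.+1] at odd frequencies with step
    [2 ^ (j.+1 - l)]. *)
Definition odd_address J j l q : nat :=
  (2 ^ (J - j.+1) * (2 ^ (j.+1 - l) * q + 1))%N.

Lemma odd_address_lt J j l q : (j < J)%N -> (l <= j)%N -> (q < 2 ^ l)%N ->
  (odd_address J j l q < 2 ^ J)%N.
Proof.
move=> jJ lj qL; have -> : (2 ^ J = 2 ^ (J - j.+1) * 2 ^ j.+1)%N.
  by rewrite -expnD subnK.
rewrite ltn_pmul2l ?expn_gt0 //.
have e2 : (1 < 2 ^ (j.+1 - l))%N by rewrite -(expn0 2) ltn_exp2l // subn_gt0 ltnS.
have -> : (2 ^ j.+1 = 2 ^ (j.+1 - l) * 2 ^ l)%N by rewrite -expnD subnK // leqW.
apply: (@leq_trans (2 ^ (j.+1 - l) * q.+1)); first by rewrite mulnS; lia.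
by rewrite leq_pmul2l // expn_gt0.
Qed.

Lemma odd_address_omega (R : realType) J j l q i : (j < J)%N -> (l <= j)%N ->
  omega R (2 ^ J) ^+ (odd_address J j l q * i) =
  omega R (2 ^ l) ^+ (i * q) * omega R (2 ^ j.+1) ^+ i.
Proof.
move=> jJ lj; rewrite /odd_address.
have -> : (2 ^ J = 2 ^ (J - j.+1) * 2 ^ j.+1)%N by rewrite -expnD subnK.
rewrite -mulnA exprM omega_mul ?expn_gt0 // mulnDl mul1n exprD; congr (_ * _).
have -> : (2 ^ j.+1 = 2 ^ (j.+1 - l) * 2 ^ l)%N by rewrite -expnD subnK // leqW.
by rewrite -mulnA exprM omega_mul ?expn_gt0 // mulnC.
Qed.

(** As the support of the periodization lies in an interval of length [2 ^ l],
    the class of [k] modulo [2 ^ l] meets it at most in [k]. *)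
Lemma alternating_samples (R : realType) J (x : 'cV[R]_(2 ^ J)) j l mu k :
  nonneg_vec x -> (l <= j)%N -> (k < 2 ^ j)%N ->
  (cyc_offset (2 ^ j) mu k < 2 ^ l)%N ->
  (forall k', (k' < 2 ^ j)%N -> periodization x j k' != 0 ->
     (cyc_offset (2 ^ j) mu k' < 2 ^ l)%N) ->
  (\sum_(i < 2 ^ J | (i == k %[mod 2 ^ l])%N) omega R (2 ^ j.+1) ^+ i * (x i 0)%:C)
    * omega R (2 ^ j.+1) ^- k =
  (periodization x j.+1 k - periodization x j.+1 (k + 2 ^ j)%N)%:C.
Proof.
move=> x0 lj kj ok supp; set w := omega R (2 ^ j.+1).
have h0 : (0 < 2 ^ j)%N by rewrite expn_gt0.
have dvd_lj : (2 ^ l %| 2 ^ j)%N by rewrite dvdn_exp2l.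
have w0 : w != 0 by rewrite omega_neq0 ?expn_gt0.
have w_mod i : w ^+ i = w ^+ (i %% 2 ^ j.+1)%N by rewrite prim_expr_mod ?omega_prim.
have -> : \sum_(i < 2 ^ J | (i == k %[mod 2 ^ l])%N) w ^+ i * (x i 0)%:C =
    \sum_(i < 2 ^ J | (i %% 2 ^ j == k)%N) w ^+ i * (x i 0)%:C.
  rewrite [LHS]big_mkcond [RHS]big_mkcond; apply: eq_bigr => i _.
  have [->|xi] := eqVneq (x i 0) 0; first by rewrite mulr0 !if_same.
  congr (if _ then _ else _); apply/eqP/eqP => [ik|<-]; last by rewrite modn_dvdm.
  apply: (@cyc_offset_inj _ _ mu _ _ dvd_lj) => //; rewrite ?ltn_pmod ?modn_dvdm //.
  apply: supp; rewrite ?ltn_pmod //.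
  by apply: contra_neq xi; apply: periodization_eq0.
rewrite sum_residue_split // mulrDl rmorphB /= /periodization !rmorph_sum /=.
rewrite -sumrN !mulr_suml; congr (_ + _); apply: eq_bigr => i /eqP ie.
  by rewrite w_mod ie [w ^+ k * _]mulrC mulfK ?expf_neq0.
rewrite w_mod ie exprD {2}/w expnS omega_half // mulrN1 mulNr mulNr.
by rewrite [w ^+ k * _]mulrC mulfK ?expf_neq0.
Qed.

(** * Locating the support *)

(** The indicator function of a set of indices, as the binary expansion of a
    number that fits into an index register. *)
Definition bitmask (b : nat -> bool) n : nat := (\sum_(i < n) b i * 2 ^ i)%N.

Lemma bitmask_bit b n k : (k < n)%N -> ((bitmask b n %/ 2 ^ k) %% 2 = b k)%N.
Proof.
rewrite /bitmask; elim: n b k => // n IH b k kn; rewrite big_ord_recl expn0 muln1.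
have -> : (\sum_(i < n) b (lift ord0 i) * 2 ^ lift ord0 i =
           (\sum_(i < n) b i.+1 * 2 ^ i) * 2)%N.
  by rewrite big_distrl; apply: eq_bigr => i _; rewrite lift0 expnSr mulnA.
rewrite addnC; case: k kn => [_|k kn].
  by rewrite expn0 divn1 modnMDl /=; case: (b 0%N).
rewrite expnS divnMA divnMDl // [(b ord0 %/ 2)%N]divn_small; last by case: (b _).
by rewrite addn0 (IH (fun i => b i.+1)).
Qed.

Lemma eq_bitmask b b' n : (forall k, (k < n)%N -> b k = b' k) ->
  bitmask b n = bitmask b' n.
Proof. by move=> bb'; apply: eq_bigr => i _; rewrite bb'. Qed.

Lemma bitmask_add (b : nat -> bool) n k (c : bool) : (k < n)%N -> b k = false ->
  (bitmask b n + c * 2 ^ k)%N =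
  bitmask (fun i => if i == k then c else b i) n.
Proof.
move=> kn bk; rewrite /bitmask (bigD1 (Ordinal kn)) //= bk mul0n add0n.
rewrite [RHS](bigD1 (Ordinal kn)) //= eqxx addnC; congr (_ + _)%N.
by apply: eq_bigr => i; rewrite -val_eqE /= => /negPf ->.
Qed.

(** The indices below [2 ^ j] with property [b] lie in the cyclic interval of
    length [2 ^ l] that starts at [mu]. *)
Definition fits j (b : nat -> bool) mu l : Prop :=
  forall k, (k < 2 ^ j)%N -> b k -> (cyc_offset (2 ^ j) mu k < 2 ^ l)%N.

(** Bit of the mask at the index in register 16, times the number of whole
    lengths [2 ^ l] by which this index lies beyond the tested start. *)
Definition overflow : iexp :=
  IMul (IMod (IDiv (IVar 12) (IExp (INum 2) (IVar 16))) (INum 2))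
       (IDiv (IMod (IAdd (IVar 16) (ISub (IExp (INum 2) (IVar 9)) (IVar 14)))
                   (IExp (INum 2) (IVar 9)))
             (IExp (INum 2) (ISub (IVar 9) (IVar 13)))).

Definition test_interval : prog :=
  SetIndex 15 (INum 0) ;;
  For 16 (IExp (INum 2) (IVar 9)) (SetIndex 15 (IAdd (IVar 15) overflow)) ;;
  IfIndexLe (IVar 15) (INum 0)
    (SetIndex 11 (ISub (IVar 9) (IVar 13)) ;; SetIndex 10 (IVar 14)) Skip.

(** Registers: 9 the level [j], 10 the start of the interval, 11 the logarithm
    of its length, 12 the bit mask of the support.  The lengths [2 ^ l] are
    tried in decreasing order, so that the last success is the shortest. *)
Definition locate : prog :=
  SetIndex 11 (IVar 9) ;;
  SetIndex 10 (INum 0) ;;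
  For 13 (IAdd (IVar 9) (INum 1)) (
    For 14 (IExp (INum 2) (IVar 9)) test_interval).

(** The register 15 adds up, over the support, the quotients of the offsets by
    [2 ^ l]; the sum vanishes exactly if all offsets are below [2 ^ l]. *)
Lemma test_interval_spec (R : realType) N (xh : 'cV[R[i]]_N) b (s : state R) :
  regs s 12 = bitmask b (2 ^ regs s 9) ->
  let l := (regs s 9 - regs s 13)%N in
  let mu := regs s 14 in
  let t := run xh test_interval s in
  frame [::] [:: 10; 11; 15; 16]%N 0 0 s t /\
  (fits (regs s 9) b mu l /\ regs t 11 = l /\ regs t 10 = mu \/
   ~ fits (regs s 9) b mu l /\ regs t 11 = regs s 11 /\ regs t 10 = regs s 10).
Proof.
move=> Sb l mu t; set j := regs s 9 in Sb l t *.
pose o k := (b k * (cyc_offset (2 ^ j) mu k %/ 2 ^ l))%N.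
pose s1 := set_reg s 15 0.
pose I k (u : state R) := regs u 15 = (\sum_(i < k) o i)%N.
have LE : ieval (regs s1) (IExp (INum 2) (IVar 9)) = (2 ^ j)%N by [].
have I0 : I 0%N s1 by rewrite /I big_ord0.
have IS k u : (k < 2 ^ j)%N ->
    frame [::] [:: 15; 16]%N (k * 0) (k * 0) s1 u -> I k u ->
    let u' := set_reg u 16 k in
    let u2 := run xh (SetIndex 15 (IAdd (IVar 15) overflow)) u' in
    frame [::] [:: 15; 16]%N 0 0 u' u2 /\ I k.+1 u2.
  move=> kj [_ ru _ _] Iu u'; split; first exact: frame_set_reg.
  rewrite /I big_ord_recr /= Iu.
  rewrite (ru 9%N isT) (ru 12%N isT) (ru 13%N isT) (ru 14%N isT); congr (_ + _)%N.
  by rewrite /= -/j Sb bitmask_bit.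
have [F H] := frame_for LE I0 IS isT; rewrite muln0 in F.
set s2 := run xh _ s1 in F H.
have r13 : regs s2 9 = j /\ regs s2 13 = regs s 13 /\ regs s2 14 = mu.
  by case: F => _ rs _ _; rewrite !rs.
have F02 : frame [::] [:: 10; 11; 15; 16]%N 0 0 s s2.
  apply: (@frame_trans _ _ _ 0 0 0 0 _ s1); first exact: frame_set_reg.
  by apply: frame_sub F => // v; rewrite !inE => /orP[] ->; rewrite ?orbT.
have okP : reflect (fits j b mu l) (regs s2 15 <= 0)%N.
  rewrite H leqn0 sum_nat_eq0; apply: (iffP forallP) => ok k.
    move=> kj bk; have := ok (Ordinal kj).
    by rewrite /= /o bk mul1n -leqn0 leqNgt divn_gt0 ?expn_gt0 // -ltnNge.
  apply/implyP => _; rewrite /o; case bk: (b k) => //.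
  by rewrite mul1n divn_small // ok.
have tE : t = if (regs s2 15 <= 0)%N
              then set_reg (set_reg s2 11 l) 10 mu else s2.
  rewrite /t [LHS]/= -/s2 /=; case: ifP => // _.
  by have [-> [-> ->]] := r13.
rewrite tE; case: okP => ok; last first.
  split => //; right; case: F => _ rs _ _; by rewrite !rs.
split; last by left.
apply: (@frame_trans _ _ _ 0 0 0 0 _ s2 _ F02).
by apply: (@frame_trans _ _ _ 0 0 0 0 _ (set_reg s2 11 l)); apply: frame_set_reg.
Qed.

Lemma locate_spec (R : realType) N (xh : 'cV[R[i]]_N) b (s : state R) :
  regs s 12 = bitmask b (2 ^ regs s 9) ->
  let j := regs s 9 in
  let t := run xh locate s in
  frame [::] [:: 10; 11; 13; 14; 15; 16]%N 0 0 s t /\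
  [/\ (regs t 10 < 2 ^ j)%N, (regs t 11 <= j)%N, fits j b (regs t 10) (regs t 11)
    & forall i mu, (i <= j)%N -> (mu < 2 ^ j)%N -> fits j b mu i ->
      (regs t 11 <= i)%N].
Proof.
move=> Sb j t; have h0 : (0 < 2 ^ j)%N by rewrite expn_gt0.
pose vars := [:: 10; 11; 13; 14; 15; 16]%N.
pose I (tried : nat -> nat -> bool) (u : state R) :=
  [/\ (regs u 10 < 2 ^ j)%N, (regs u 11 <= j)%N, fits j b (regs u 10) (regs u 11)
    & forall i mu, (i <= j)%N -> (mu < 2 ^ j)%N -> tried i mu -> fits j b mu i ->
      (regs u 11 <= i)%N].
pose Io c := I (fun i _ => j < i + c)%N.
pose Ii c m := I (fun i mu => (j < i + c) || ((i + c == j) && (mu < m)))%N.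
pose s1 := set_reg (set_reg s 11 j) 10 0.
have F01 : frame [::] vars 0 0 s s1.
  by apply: (@frame_trans _ _ _ 0 0 0 0 _ (set_reg s 11 j)); apply: frame_set_reg.
have cE : ieval (regs s1) (IAdd (IVar 9) (INum 1)) = j.+1 by rewrite /= addn1.
have I0 : Io 0%N s1.
  split=> //= [k kj _|i mu ij _]; first exact: cyc_offset_lt.
  by rewrite addn0 ltnNge ij.
have IS c u : (c < j.+1)%N -> frame [::] vars (c * 0) (c * 0) s1 u -> Io c u ->
    let u' := set_reg u 13 c in
    let u2 := run xh (For 14 (IExp (INum 2) (IVar 9)) test_interval) u' in
    frame [::] vars 0 0 u' u2 /\ Io c.+1 u2.
  move=> cj Fu Iu u'; rewrite ltnS in cj.
  have mE : ieval (regs u') (IExp (INum 2) (IVar 9)) = (2 ^ j)%N.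
    by rewrite /=; case: Fu => _ ->.
  have J0 : Ii c 0%N u'.
    by case: Iu => ? ? ? min; split=> // i mu ij mj; rewrite ltn0 andbF orbF; apply: min.
  have JS m v : (m < 2 ^ j)%N ->
      frame [::] [:: 10; 11; 14; 15; 16]%N (m * 0) (m * 0) u' v -> Ii c m v ->
      let v' := set_reg v 14 m in
      let v2 := run xh test_interval v' in
      frame [::] [:: 10; 11; 14; 15; 16]%N 0 0 v' v2 /\ Ii c m.+1 v2.
    move=> mj Fv [mu_lt l_le fit min] v'.
    have v'9 : regs v' 9 = j.
      by rewrite /=; case: Fv => _ /= -> //; case: Fu => _ ->.
    have v'13 : regs v' 13 = c by rewrite /=; case: Fv => _ /= ->.
    have v'12 : regs v' 12 = bitmask b (2 ^ regs v' 9).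
      rewrite v'9 /=; case: Fv => _ /= -> //= _ _; case: Fu => _ -> //.
    have [Ft alt] := test_interval_spec xh v'12.
    rewrite v'9 v'13 [regs v' 14]/= in alt.
    set v2 := run xh test_interval v' in Ft alt *.
    split.
      by apply: frame_sub Ft => // w; rewrite !inE => /or4P[] ->; rewrite ?orbT.
    case: alt => [[fit' [r11 r10]]|[nofit [r11 r10]]]; rewrite /Ii /I r11 r10.
      split=> //; first exact: leq_subr.
      by move=> i mu ij _ /orP[|/andP[/eqP]] *; lia.
    split=> // i mu ij mj' tried fit'; apply: (min i mu) => //.
    case/orP: tried => [->//|/andP[/eqP ic]].
    rewrite ltnS leq_eqVlt => /orP[/eqP mum|->]; last by rewrite ic eqxx orbT.
    by case: nofit; rewrite -mum (_ : (j - c)%N = i) //; lia.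
  have [F H] := frame_for mE J0 JS isT; rewrite muln0 in F; split.
    apply: frame_sub F => // w; rewrite !inE.
    by case/or4P=> [->|->|->|/orP[] ->]; rewrite ?orbT.
  case: H => ? ? ? min; split=> // i mu ij mj tried; apply: min => //.
  by rewrite mj andbT; move: tried; rewrite addnS ltnS leq_eqVlt orbC eq_sym.
have [F H] := frame_for cE I0 IS isT; rewrite muln0 in F.
split; first exact: (@frame_trans _ _ _ 0 0 0 0 _ s1 _ F01 F).
case: H => ? ? ? min; split=> // i mu ij mj; apply: min => //.
by rewrite addnS ltnS leq_addl.
Qed.

(** * Doubling the period *)

(** Registers 9 to 12 are those of the search for the interval.  Array 2 holds
    the inverse transform of the samples, array 3 is never written and serves
    as a source of zeros. *)
Definition sample_address : iexp :=
  IMul (IExp (INum 2) (ISub (IVar 0) (IAdd (IVar 9) (INum 1))))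
       (IAdd (IMul (IExp (INum 2) (ISub (IAdd (IVar 9) (INum 1)) (IVar 11)))
                   (IVar 1))
             (INum 1)).

Definition upper : iexp := IAdd (IVar 16) (IExp (INum 2) (IVar 9)).

(** The known sum of two entries and their difference, which the transform
    yields up to a root of unity, give the entries themselves. *)
Definition split_entry : prog :=
  Root (Cell 1 (INum 0)) (IExp (INum 2) (IAdd (IVar 9) (INum 1)))
       (ISub (IExp (INum 2) (IAdd (IVar 9) (INum 1))) (IVar 16)) ;;
  Arith OpMul (Cell 1 (INum 1))
        (Cell 2 (IMod (IVar 16) (IExp (INum 2) (IVar 11)))) (Cell 1 (INum 0)) ;;
  Arith OpSub (Cell 1 (INum 1)) (Cell 0 (IVar 16)) (Cell 1 (INum 1)) ;;
  Const (Cell 1 (INum 0)) (INum 2) ;;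
  Arith OpDiv (Cell 0 upper) (Cell 1 (INum 1)) (Cell 1 (INum 0)) ;;
  Arith OpSub (Cell 0 (IVar 16)) (Cell 0 (IVar 16)) (Cell 0 upper).

Definition mark (e : iexp) : prog :=
  IfLe (Cell 0 e) (Cell 3 (INum 0)) Skip
    (SetIndex 12 (IAdd (IVar 12) (IExp (INum 2) e))).

Definition refine_entry : prog :=
  SetIndex 16 (IMod (IAdd (IVar 10) (IVar 17)) (IExp (INum 2) (IVar 9))) ;;
  split_entry ;; mark (IVar 16) ;; mark upper.

Definition refine : prog :=
  ifft 2 11 sample_address ;;
  SetIndex 12 (INum 0) ;;
  For 17 (IExp (INum 2) (IVar 11)) refine_entry.

Lemma split_entry_spec (R : realType) N (xh : 'cV[R[i]]_N) (u v : R[i])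
    (s : state R) :
  (regs s 16 < 2 ^ regs s 9)%N ->
  memory s 0 (regs s 16) = u + v ->
  memory s 2 (regs s 16 %% 2 ^ regs s 11)%N
    * omega R (2 ^ (regs s 9).+1) ^- regs s 16 = u - v ->
  let t := run xh split_entry s in
  frame [:: 0; 1]%N [::] 6 0 s t /\
  forall p, memory t 0 p =
    if p == regs s 16 then u
    else if p == (regs s 16 + 2 ^ regs s 9)%N then v else memory s 0 p.
Proof.
move=> kh sum_uv diff_uv.
have ne : (regs s 16 == regs s 16 + 2 ^ regs s 9)%N = false.
  by rewrite -{1}[regs s 16]addn0 eqn_add2l ltn_eqF // expn_gt0.
split.
  split=> [[|[|b]] p|||] //=; rewrite ?addn0 //.
  by rewrite !addnS addn0.
move=> p; rewrite /= !addn1 omega_exp_sub ?expn_gt0 //; last first.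
  by rewrite expnS; lia.
rewrite diff_uv !eqxx !ne !sum_uv /=.
have -> : (u + v - (u - v)) / 2 = v :> R[i].
  have two : 2 != 0 :> R[i] by rewrite pnatr_eq0.
  by field.
rewrite addrK; case: eqP => //.
Qed.

Lemma mark_spec (R : realType) N (xh : 'cV[R[i]]_N) e (r : R) (s : state R) :
  memory s 0 (ieval (regs s) e) = r%:C -> memory s 3 0 = 0 -> 0 <= r ->
  let t := run xh (mark e) s in
  [/\ frame [::] [:: 12]%N 1 0 s t, memory t = memory s &
      regs t 12 = (regs s 12 + (r != 0%R) * 2 ^ ieval (regs s) e)%N].
Proof.
move=> er z r0 t.
have -> : t = if r <= 0 then add_flop s
    else set_reg (add_flop s) 12 (regs s 12 + 2 ^ ieval (regs s) e)%N.
  by rewrite /t /= er z.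
rewrite [r <= 0]le_eqVlt ltNge r0 orbF.
case: eqP => _; rewrite ?mul0n ?mul1n ?addn0; split=> //.
  by split; rewrite ?addn0 ?addn1.
by split=> [||/=|/=]; rewrite ?addn0 ?addn1 // => v; rewrite inE /= => /negPf->.
Qed.

(** The state that the algorithm maintains at level [j]. *)
Definition stores (R : realType) J (x : 'cV[R]_(2 ^ J)) j (s : state R) : Prop :=
  [/\ regs s 0 = J, regs s 12 = bitmask (fun k => periodization x j k != 0) (2 ^ j),
      memory s 3 0 = 0 &
      forall p, memory s 0 p = if (p < 2 ^ j)%N then (periodization x j p)%:C else 0].

Definition refine_vars : seq nat := [:: 12; 16; 17]%N ++ iota 1 8.
Definition refine_cost l : nat := (ifft_cost l + 2 ^ l * 8)%N.

(** The loop invariant says which indices [k] below [2 ^ j] are done: those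
    whose offset in the interval is below the loop variable.  At the indices
    outside the interval the periodization is zero at both levels, so that
    the cells left alone are correct as well. *)
Lemma refine_spec (R : realType) J (x : 'cV[R]_(2 ^ J)) (s : state R) :
  let j := regs s 9 in let mu := regs s 10 in let l := regs s 11 in
  nonneg_vec x -> (j < J)%N -> (mu < 2 ^ j)%N -> (l <= j)%N ->
  fits j (fun k => periodization x j k != 0) mu l -> stores x j s ->
  let t := run (dft x) refine s in
  frame [:: 0; 1; 2]%N refine_vars (refine_cost l) (2 ^ l) s t /\
  stores x j.+1 t.
Proof.
move=> j mu l x0 jJ muj lj fit [rJ rS z m0] t.
have h0 : (0 < 2 ^ j)%N by rewrite expn_gt0.
have l_le_h : (2 ^ l <= 2 ^ j)%N by rewrite leq_exp2l.
have [|F1 H1] := @ifft_spec R _ (dft x) 2 11 sample_address (odd_address J j l)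
  s isT isT.
  move=> r rs; rewrite /sample_address /= (rs 0%N isT) (rs 9%N isT) (rs 11%N isT).
  by rewrite rJ addn1.
rewrite -/l in F1 H1; set s1 := run (dft x) (ifft _ _ _) s in F1 H1.
have [m1 r1 _ _] := F1.
have y1 k : (k < 2 ^ j)%N -> (cyc_offset (2 ^ j) mu k < 2 ^ l)%N ->
    memory s1 2 (k %% 2 ^ l)%N * omega R (2 ^ j.+1) ^- k =
    (periodization x j.+1 k - periodization x j.+1 (k + 2 ^ j)%N)%:C.
  move=> kj ok; rewrite H1 ?ltn_pmod ?expn_gt0 //.
  rewrite (aliasing _ _ (c := fun i => omega R (2 ^ j.+1) ^+ i)).
  - rewrite -(alternating_samples x0 lj kj ok fit); congr (_ * _).
    by apply: eq_bigl => i; rewrite modn_mod.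
  - by move=> q ql; apply: odd_address_lt.
  - by move=> q i; apply: odd_address_omega.
pose s2 := set_reg s1 12 0.
pose b c i := (cyc_offset (2 ^ j) mu (i %% 2 ^ j) < c)%N && (periodization x j.+1 i != 0).
pose I c (u : state R) :=
  [/\ forall k, (k < 2 ^ j)%N -> memory u 0 k =
        if (cyc_offset (2 ^ j) mu k < c)%N then (periodization x j.+1 k)%:C
        else (periodization x j k)%:C,
      forall k, (k < 2 ^ j)%N -> memory u 0 (k + 2 ^ j)%N =
        if (cyc_offset (2 ^ j) mu k < c)%N
        then (periodization x j.+1 (k + 2 ^ j)%N)%:C else 0,
      forall p, (2 ^ j.+1 <= p)%N -> memory u 0 p = 0 &
      regs u 12 = bitmask (b c) (2 ^ j.+1)].
have LE : ieval (regs s2) (IExp (INum 2) (IVar 11)) = (2 ^ l)%N by rewrite /= r1.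
have I0 : I 0%N s2.
  split=> [k kj|k kj|p pj|].
  - by rewrite /= m1 // m0 kj.
  - by rewrite /= m1 // m0 ltnNge leq_addl.
  - rewrite /= m1 // m0 ltnNge (leq_trans _ pj) //.
    by rewrite leq_exp2l // leqnSn.
  by rewrite /= /bitmask big1.
have IS c u : (c < 2 ^ l)%N ->
    frame [:: 0; 1]%N [:: 12; 16; 17]%N (c * 8) (c * 0) s2 u -> I c u ->
    let u' := set_reg u 17 c in
    let u2 := run (dft x) refine_entry u' in
    frame [:: 0; 1]%N [:: 12; 16; 17]%N 8 0 u' u2 /\ I c.+1 u2.
  move=> cl [mu_ ru _ _] [Ilo Ihi Iz Imask] u'.
  have cj : (c < 2 ^ j)%N by apply: leq_trans l_le_h.
  pose k := ((mu + c) %% 2 ^ j)%N.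
  have kj : (k < 2 ^ j)%N by rewrite ltn_pmod.
  have ok : cyc_offset (2 ^ j) mu k = c by apply/eqP; rewrite cyc_offset_eq.
  have offE k' : (k' < 2 ^ j)%N -> (cyc_offset (2 ^ j) mu k' < c.+1)%N =
      (k' == k) || (cyc_offset (2 ^ j) mu k' < c)%N.
    by move=> k'j; rewrite ltnS leq_eqVlt cyc_offset_eq.
  pose u1 := set_reg u' 16 k.
  have ru9 : regs u 9 = j by rewrite ru //= r1.
  have ru10 : regs u 10 = mu by rewrite ru //= r1.
  have ru11 : regs u 11 = l by rewrite ru //= r1.
  have u1E : run (dft x) (SetIndex 16 (IMod (IAdd (IVar 10) (IVar 17))
      (IExp (INum 2) (IVar 9)))) u' = u1.
    by rewrite /= ru9 ru10.
  have r16 : regs u1 16 = k by [].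
  have r9 : regs u1 9 = j by [].
  have r11 : regs u1 11 = l by [].
  have p0 i : 0 <= periodization x j.+1 i by apply: periodization_ge0.
  have [||| F2 H2] := @split_entry_spec R _ (dft x)
    (periodization x j.+1 k)%:C (periodization x j.+1 (k + 2 ^ j)%N)%:C u1.
  - by rewrite r9.
  - rewrite r16 [memory u1 _ _]Ilo // ok ltnn -rmorphD /=.
    by rewrite periodization_split.
  - by rewrite r16 r11 r9 [memory u1 _ _]mu_ // -rmorphB y1 ?ok.
  rewrite r16 r9 in H2; set u2 := run (dft x) split_entry u1 in F2 H2.
  have [m2 r2 _ _] := F2.
  have r2_16 : ieval (regs u2) (IVar 16) = k by apply: r2.
  have [||| F3 m3 S3] := @mark_spec R _ (dft x) (IVar 16) (periodization x j.+1 k) u2.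
  - by rewrite r2_16 H2 eqxx.
  - by rewrite m2 //= mu_ //= m1.
  - by [].
  set u3 := run (dft x) (mark (IVar 16)) u2 in F3 m3 S3.
  have [_ r3 _ _] := F3.
  have upperE : ieval (regs u3) upper = (k + 2 ^ j)%N.
    rewrite -[LHS]/(regs u3 16 + 2 ^ regs u3 9)%N.
    by rewrite (r3 16%N isT) (r3 9%N isT) (r2 16%N isT) (r2 9%N isT) r9.
  have kne : (k + 2 ^ j == k)%N = false.
    by rewrite -{2}[k]addn0 eqn_add2l gtn_eqF.
  have [||| F4 m4 S4] := @mark_spec R _ (dft x) upper
    (periodization x j.+1 (k + 2 ^ j)%N) u3.
  - by rewrite upperE m3 H2 kne eqxx.
  - by rewrite m3 m2 //= mu_ //= m1.
  - by [].
  set u4 := run (dft x) (mark upper) u3 in F4 m4 S4.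
  have -> : run (dft x) refine_entry u' = u4 by rewrite /u4 /u3 /u2 -u1E.
  split.
    have F1' : frame [:: 0; 1]%N [:: 12; 16; 17]%N 0 0 u' u1 by exact: frame_set_reg.
    have sub12 : {subset [:: 12%N] <= [:: 12; 16; 17]%N}.
      by move=> v; rewrite !inE => ->.
    apply: (frame_trans F1' (frame_trans (frame_sub _ _ F2)
      (frame_trans (frame_sub _ sub12 F3) (frame_sub _ sub12 F4)))) => //.
  split=> [k' k'j|k' k'j|p pj|].
  - rewrite m4 m3 H2 offE //; case: eqP => [->|_] //=.
    have -> : (k' == k + 2 ^ j)%N = false by lia.
    exact: Ilo.
  - rewrite m4 m3 H2 offE // eqn_add2r.
    have -> : (k' + 2 ^ j == k)%N = false by lia.
    by case: eqP => [->|_] //=; exact: Ihi.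
  - rewrite m4 m3 H2; rewrite expnS in pj.
    have -> : (p == k)%N = false by lia.
    have -> : (p == k + 2 ^ j)%N = false by lia.
    by rewrite [LHS]/= Iz // expnS.
  rewrite S4 S3 upperE r2_16 (r2 12%N isT) -[regs u1 12]/(regs u 12) Imask.
  have kmod : ((k + 2 ^ j) %% 2 ^ j = k)%N by rewrite modnDr modn_small.
  have k_lt : (k < 2 ^ j.+1)%N by rewrite expnS; lia.
  have kh_lt : (k + 2 ^ j < 2 ^ j.+1)%N by rewrite expnS; lia.
  rewrite (bitmask_add _ k_lt); last by rewrite /b modn_small // ok ltnn.
  rewrite (bitmask_add _ kh_lt); last by rewrite kne /b kmod ok ltnn.
  apply: eq_bitmask => i ij; rewrite /b offE ?ltn_pmod //.
  rewrite expnS in ij; rewrite (modn_double ij kj).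
  case: eqP => [->|_]; first by rewrite orbT.
  by case: eqP => [->|].
have [F H] := frame_for LE I0 IS isT; rewrite muln0 in F.
rewrite -[run _ _ s2]/t in F H; split.
  rewrite -[(2 ^ l)%N in X in frame _ _ _ X]addn0.
  have F12 : frame [:: 0; 1; 2]%N refine_vars 0 0 s1 s2 by exact: frame_set_reg.
  apply: (frame_trans (frame_sub _ _ F1) (frame_trans F12 (frame_sub _ _ F))).
  - by move=> v; rewrite !inE => /orP[] ->; rewrite ?orbT.
  - by move=> v; rewrite mem_cat => ->; rewrite orbT.
  - by move=> v; rewrite !inE => /orP[] ->; rewrite ?orbT.
  - by move=> v; rewrite mem_cat => ->.
have [mt rt _ _] := F; have [Ilo Ihi Iz Imask] := H.
have out k : (k < 2 ^ j)%N -> (cyc_offset (2 ^ j) mu k < 2 ^ l)%N = false ->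
    periodization x j k = 0.
  by move=> kj ok; apply/eqP; apply: contraFT ok; apply: fit.
split.
- by rewrite rt //= r1.
- rewrite Imask; apply: eq_bitmask => i ij; rewrite /b.
  case ok: (_ < _)%N => //=; apply/esym/negbTE; rewrite negbK.
  have kj : (i %% 2 ^ j < 2 ^ j)%N by rewrite ltn_pmod.
  have [lo hi] := periodization_split_eq0 x0 kj (out _ kj ok).
  have := modn_double (r := i) (k := (i %% 2 ^ j)%N) _ kj.
  by rewrite -expnS eqxx => /(_ ij)/esym/orP[] /eqP ->; apply/eqP.
- by rewrite mt //= m1.
move=> p; case: ltnP => pj; last exact: Iz.
rewrite expnS in pj; case: (ltnP p (2 ^ j)) => ph.
  rewrite Ilo //; case: ifP => // ok.
  by have [-> _] := periodization_split_eq0 x0 ph (out _ ph ok); rewrite out.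
have kj : (p - 2 ^ j < 2 ^ j)%N by lia.
rewrite -(subnK ph) Ihi //; case: ifP => // ok.
by have [_ ->] := periodization_split_eq0 x0 kj (out _ kj ok).
Qed.

(** * The algorithm *)

(** At level 0 the periodization is the sum of all entries, which is the sample
    of index 0.  Register 18 ends up positive exactly if the interval of the
    last level is longer than [2 ^ J / 4]. *)
Definition detect : prog :=
  Fetch (Cell 0 (INum 0)) (INum 0) ;;
  mark (INum 0) ;;
  For 9 (ISub (IVar 0) (INum 1)) (locate ;; refine) ;;
  SetIndex 9 (ISub (IVar 0) (INum 1)) ;;
  locate ;;
  SetIndex 18 (ISub (IMul (INum 4) (IExp (INum 2) (IVar 11)))
                    (IExp (INum 2) (IVar 0))).

(** At every level from [e] on, an interval of length [2 ^ e] contains the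
    support. *)
Definition covers (R : realType) J (x : 'cV[R]_(2 ^ J)) e : Prop :=
  forall j, (j < J)%N -> (e <= j)%N ->
    exists2 mu, (mu < 2 ^ j)%N & fits j (fun k => periodization x j k != 0) mu e.

(** Reduction modulo [2 ^ j] maps a cyclic interval modulo [2 ^ J] into one of
    the same length. *)
Lemma covers_support (R : realType) J (x : 'cV[R]_(2 ^ J)) mu m e :
  vanishes_outside x mu m -> (m <= 2 ^ e)%N -> covers x e.
Proof.
move=> van me j jJ ej; have h0 : (0 < 2 ^ j)%N by rewrite expn_gt0.
exists (mu %% 2 ^ j)%N => [|k kj]; first by rewrite ltn_pmod.
apply: contraNT => ok; apply/eqP; apply: big1 => i /eqP ik.
apply: van => -[l lm il]; case/negP: ok.
have l_lt : (l < 2 ^ e)%N by apply: leq_trans lm me.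
have lj : (l < 2 ^ j)%N by apply: leq_trans l_lt _; rewrite leq_exp2l.
suff /eqP -> : cyc_offset (2 ^ j) (mu %% 2 ^ j) k == l by [].
rewrite cyc_offset_eq ?ltn_pmod // modnDml -ik il modn_dvdm //.
by rewrite dvdn_exp2l // ltnW.
Qed.

(** Undoing one periodization at most adds half a turn to the interval. *)
Lemma fits_vanishes (R : realType) j (x : 'cV[R]_(2 ^ j.+1)) mu l :
  nonneg_vec x -> (mu < 2 ^ j)%N -> (l <= j)%N ->
  fits j (fun k => periodization x j k != 0) mu l ->
  vanishes_outside x mu (2 ^ l + 2 ^ j).
Proof.
move=> x0 muj lj fit i out; apply/eqP; apply: contra_notT out => xi.
have h0 : (0 < 2 ^ j)%N by rewrite expn_gt0.
have kj : (i %% 2 ^ j < 2 ^ j)%N by rewrite ltn_pmod.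
have ok : (cyc_offset (2 ^ j) mu (i %% 2 ^ j) < 2 ^ l)%N.
  by apply: fit => //; apply: contra_neq xi; apply: periodization_eq0.
set o := cyc_offset _ _ _ in ok.
have oj : (o < 2 ^ j)%N by rewrite ltn_pmod.
have /eqP ki : (i %% 2 ^ j == (mu + o) %% 2 ^ j)%N by rewrite -cyc_offset_eq.
pose r := ((mu + o) %% 2 ^ j.+1)%N; have h2 : (2 ^ j.+1 = 2 * 2 ^ j)%N by rewrite expnS.
have rN : (r < 2 * 2 ^ j)%N by rewrite -h2 ltn_pmod ?expn_gt0.
have iN : (i < 2 * 2 ^ j)%N by rewrite -h2.
have := modn_double iN kj; rewrite eqxx => /esym i_alt.
have := modn_double rN kj; rewrite modn_dvdm ?dvdn_exp2l // ki eqxx -ki.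
move=> /esym r_alt.
have [ir|ir] := eqVneq (i : nat) r; first by exists o; [lia | rewrite ir].
exists (o + 2 ^ j)%N; first by lia.
rewrite addnA -modnDml -/r [in RHS]h2; move: i_alt r_alt ir; set k := (i %% _)%N in kj *.
case/orP=> /eqP ->; case/orP=> /eqP ->; rewrite ?eqxx // => _.
  by rewrite -addnA addnn -mul2n modnDr modn_small; lia.
by rewrite modn_small; lia.
Qed.

Lemma stores_frame (R : realType) J (x : 'cV[R]_(2 ^ J)) j arrs vars f q
    (s t : state R) :
  0%N \notin arrs -> 3%N \notin arrs -> 0%N \notin vars -> 12%N \notin vars ->
  frame arrs vars f q s t -> stores x j s -> stores x j t.
Proof.
move=> a0 a3 v0 v12 [mt rt _ _] [r0 r12 z m0].
by split=> [|||p]; rewrite ?mt ?rt ?m0.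
Qed.

(** * Costs of the levels *)

Definition level_cost l : nat := (2 ^ l * (2 * l + 10))%N.

Lemma ifft_cost_le l : (ifft_cost l <= level_cost l)%N.
Proof.
rewrite /ifft_cost /level_cost; case: l => [|l] //=.
rewrite expnS; have := expn_gt0 2 l; nia.
Qed.

Lemma refine_cost_le l : (refine_cost l <= level_cost l)%N.
Proof.
rewrite /refine_cost /ifft_cost /level_cost; case: l => [|l] //=.
rewrite expnS; have := expn_gt0 2 l; nia.
Qed.

Lemma level_cost_double l : (2 * level_cost l <= level_cost l.+1)%N.
Proof. by rewrite /level_cost expnS; nia. Qed.

Lemma level_cost_next l : (level_cost l.+1 <= 3 * level_cost l)%N.
Proof. by rewrite /level_cost expnS; nia. Qed.

Lemma level_cost_mono : {homo level_cost : l l' / (l <= l')%N}.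
Proof.
move=> l l' ll'; rewrite /level_cost leq_mul ?leq_exp2l //.
by rewrite leq_add2r leq_mul2l.
Qed.

(** The levels below [e] form a geometric series; each later level costs as
    much as level [e]. *)
Lemma sum_levels (c : nat -> nat) e n :
  (forall l, 2 * c l <= c l.+1)%N ->
  (\sum_(j < n) c (minn j e) <= c (minn n e) + (n - e) * c e)%N.
Proof.
move=> c2; elim: n => [|n IH]; first by rewrite big_ord0.
rewrite big_ord_recr /=; have [ne|en] := ltnP n e.
  have := c2 n; rewrite (minn_idPl (ltnW ne)) in IH *.
  rewrite (minn_idPl ne) (eqP (ne : n.+1 - e == 0)%N) (eqP (ltnW ne : n - e == 0)%N) in IH *.
  by move: IH; set S := (\sum_(i < n) _)%N; lia.
rewrite (minn_idPr en) in IH *; rewrite (minn_idPr (leqW en)) subSn //.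
by move: IH; set S := (\sum_(i < n) _)%N; lia.
Qed.

(** * Runs of the algorithm *)

Definition within_levels (R : realType) e n (s : state R) : Prop :=
  (flops s <= 1 + \sum_(j < n) level_cost (minn j e))%N /\
  (samples s <= 1 + \sum_(j < n) 2 ^ minn j e)%N.

Definition located (R : realType) J (x : 'cV[R]_(2 ^ J)) j (s : state R) : Prop :=
  let b k := periodization x j k != 0 in
  [/\ regs s 9 = j, (regs s 10 < 2 ^ j)%N, (regs s 11 <= j)%N,
      fits j b (regs s 10) (regs s 11)
    & forall i mu, (i <= j)%N -> (mu < 2 ^ j)%N -> fits j b mu i ->
      (regs s 11 <= i)%N].

Lemma located_le (R : realType) J (x : 'cV[R]_(2 ^ J)) j e (s : state R) :
  covers x e -> (j < J)%N -> located x j s -> (regs s 11 <= minn j e)%N.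
Proof.
move=> cov jJ [_ _ lj _ min]; rewrite leq_min lj /=.
have [je|ej] := ltnP j e; first exact: leq_trans lj (ltnW je).
by have [mu muj fit] := cov j jJ ej; apply: min fit.
Qed.

Lemma run_then (R : realType) N (xh : 'cV[R[i]]_N) p q s :
  run xh (p ;; q) s = run xh q (run xh p s).
Proof. by []. Qed.

Lemma stores_set_level (R : realType) J (x : 'cV[R]_(2 ^ J)) j n (s : state R) :
  stores x j s -> stores x j (set_reg s 9 n).
Proof. by case. Qed.

Lemma locate_stores (R : realType) J (x : 'cV[R]_(2 ^ J)) j (s : state R) :
  stores x j s -> regs s 9 = j ->
  let t := run (dft x) locate s in
  [/\ stores x j t, located x j t, flops t = flops s & samples t = samples s].
Proof.
move=> st r9 t.
have [|F H] := @locate_spec R _ (dft x) (fun k => periodization x j k != 0) s.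
  by rewrite r9; case: st.
rewrite r9 in H; have [_ rt ft qt] := F; have [H10 H11 fit min] := H.
split; [exact: stores_frame F st | split=> // | by rewrite ft addn0 |].
  by rewrite rt.
by rewrite qt addn0.
Qed.

Lemma refine_within (R : realType) J (x : 'cV[R]_(2 ^ J)) j e (s : state R) :
  nonneg_vec x -> covers x e -> (j < J)%N ->
  stores x j s -> located x j s -> within_levels e j s ->
  let t := run (dft x) refine s in stores x j.+1 t /\ within_levels e j.+1 t.
Proof.
move=> x0 cov jJ st loc [fs qs] t; have le_l := located_le cov jJ loc.
have [r9 muj lj fit _] := loc; rewrite -r9 in jJ muj lj fit st.
have [[_ _ ft qt] st'] := refine_spec x0 jJ muj lj fit st.
rewrite r9 in st'; split => //; rewrite /within_levels ft qt !big_ord_recr /= !(addnA 1%N).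
split; last by apply: leq_add => //; rewrite leq_exp2l.
apply: leq_add => //.
exact: leq_trans (refine_cost_le _) (level_cost_mono le_l).
Qed.

(** The loop computes level [j.+1] from level [j] up to level [J.-1], whose
    interval is located as well. *)
Lemma detect_spec (R : realType) J (x : 'cV[R]_(2 ^ J)) e :
  (0 < J)%N -> nonneg_vec x -> covers x e ->
  let t := run (dft x) detect (init_state R J) in
  [/\ stores x J.-1 t, located x J.-1 t, within_levels e J.-1 t &
      regs t 18 = (4 * 2 ^ regs t 11 - 2 ^ J)%N].
Proof.
move=> J0 x0 cov t.
pose s1 := run (dft x) (Fetch (Cell 0 (INum 0)) (INum 0)) (init_state R J).
have m1 : memory s1 0 0 = (periodization x 0 0)%:C.
  rewrite /= sample_dft ?expn_gt0 // periodization0 rmorph_sum /=.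
  by apply: eq_bigr => i _; rewrite mul0n expr0 mul1r.
have [||| F2 m2 S2] := @mark_spec R _ (dft x) (INum 0) (periodization x 0 0) s1.
- exact: m1.
- by [].
- exact: periodization_ge0.
set s2 := run _ _ s1 in F2 m2 S2; have [_ r2 f2 q2] := F2.
have st2 : stores x 0 s2.
  split; rewrite ?m2 //; first by rewrite r2.
    by rewrite S2 /= add0n /bitmask expn0 big_ord1 expn0.
  by case=> [|p]; [exact: m1 | by []].
pose I j (u : state R) := stores x j u /\ within_levels e j u.
have nE : ieval (regs s2) (ISub (IVar 0) (INum 1)) = J.-1.
  by rewrite -[LHS]/(regs s2 0 - 1)%N r2 // subn1.
set s3 := run (dft x) (For 9 (ISub (IVar 0) (INum 1)) (locate ;; refine)) s2.
have [st3 w3] : I J.-1 s3.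
  rewrite -nE /s3; apply: run_for => [|j u]; last rewrite nE => jJ [st w].
    by split=> //; split; rewrite big_ord0 ?f2 ?q2.
  have [st' loc ff qq] := locate_stores (stores_set_level j st) (erefl j).
  rewrite run_then; apply: refine_within => //; first by lia.
  by case: w => ? ?; split; rewrite ?ff ?qq.
have n3 : ieval (regs s3) (ISub (IVar 0) (INum 1)) = J.-1.
  by rewrite -[LHS]/(regs s3 0 - 1)%N subn1; case: st3 => ->.
have [st4 loc4 f4 q4] := locate_stores (stores_set_level J.-1 st3) (erefl J.-1).
set s4 := run (dft x) locate _ in st4 loc4 f4 q4.
pose s5 := set_reg s4 18 (4 * 2 ^ regs s4 11 - 2 ^ regs s4 0).
have -> : t = s5.
  by rewrite /t /detect !run_then -/s1 -/s2 -/s3 [run _ (SetIndex 9 _) _]/set_reg n3.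
have r4 : regs s4 0 = J by case: st4.
split.
- by case: st4 => *; split.
- by case: loc4 => *; split.
- by case: w3 => ? ?; split; rewrite [_ s5]f4 || rewrite [_ s5]q4.
- by rewrite -[LHS]/(4 * 2 ^ regs s4 11 - 2 ^ regs s4 0)%N r4.
Qed.

(** With as many samples as entries, every class modulo the length of the
    transform is a single index. *)
Lemma radix2_ifft_dft (R : realType) J (x : 'cV[R]_(2 ^ J)) (s : state R) :
  regs s 0 = J ->
  let t := run (dft x) radix2_ifft s in
  [/\ forall k : 'I_(2 ^ J), memory t 0 k = (x k 0)%:C,
      flops t = (flops s + ifft_cost J)%N & samples t = (samples s + 2 ^ J)%N].
Proof.
move=> rJ; rewrite radix2_ifftE => t.
have [|[_ _ ft qt] H] := @ifft_spec R _ (dft x) 0 0 (IVar 1) id s isT isT.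
  by [].
rewrite rJ in ft qt H; split=> // k; rewrite H //.
rewrite (aliasing (g := id) _ _ (c := fun=> 1)) => [||q i] //; last by rewrite mulr1 mulnC.
rewrite (eq_bigl (pred1 k)) ?big_pred1_eq ?mul1r // => i.
by rewrite !modn_small.
Qed.

Definition algorithm : prog :=
  Then detect (IfIndexLe (IVar 18) (INum 0) refine radix2_ifft).

(** If the last interval is longer than a quarter of the circle, then [J] is at
    most [e.+1], so that the full transform costs no more than a constant
    number of levels. *)
Lemma algorithm_spec (R : realType) J (x : 'cV[R]_(2 ^ J)) e :
  (0 < J)%N -> nonneg_vec x -> (e <= J)%N -> covers x e ->
  let t := run (dft x) algorithm (init_state R J) in
  [/\ forall k : 'I_(2 ^ J), memory t 0 k = (x k 0)%:C,
      (flops t <= level_cost e * (J - e + 5))%N &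
      (samples t <= 2 ^ e * (J - e + 4))%N].
Proof.
move=> J0 x0 eJ cov t.
have [st loc w flagE] := detect_spec J0 x0 cov.
set s := run (dft x) detect _ in st loc w flagE.
have tE : t = if (regs s 18 <= 0)%N then run (dft x) refine s
              else run (dft x) radix2_ifft s by [].
have jJ : (J.-1 < J)%N by rewrite prednK.
have ce1 : (1 <= level_cost e)%N by rewrite /level_cost; have := expn_gt0 2 e; nia.
have two_double l : (2 * 2 ^ l <= 2 ^ l.+1)%N by rewrite expnS.
have sumF n : (\sum_(j < n) level_cost (minn j e) <= level_cost e + (n - e) * level_cost e)%N.
  apply: leq_trans (sum_levels e n level_cost_double) _.
  by rewrite leq_add2r level_cost_mono // geq_minr.
have sumS n : (\sum_(j < n) 2 ^ minn j e <= 2 ^ e + (n - e) * 2 ^ e)%N.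
  apply: leq_trans (sum_levels e n two_double) _.
  by rewrite leq_add2r leq_exp2l // geq_minr.
have e0 : (0 < 2 ^ e)%N by rewrite expn_gt0.
rewrite tE; case: ifPn => flag0.
  have [st' [fs qs]] := refine_within x0 cov jJ st loc w.
  rewrite prednK // in st' fs qs; set u := run _ _ s in st' fs qs *.
  split=> [k||].
  - by case: st' => _ _ _ ->; rewrite ltn_ord periodization_full.
  - by apply: leq_trans fs _; have := sumF J; set S := (\sum_(i < J) _)%N; nia.
  - by apply: leq_trans qs _; have := sumS J; set S := (\sum_(i < J) _)%N; nia.
have Je : (J <= e.+1)%N.
  have le_e : (regs s 11 <= e)%N.
    by have := located_le cov jJ loc; rewrite leq_min => /andP[].
  move: flag0; rewrite leqn0 flagE subn_eq0 -ltnNge.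
  have -> : (4 * 2 ^ regs s 11 = 2 ^ (2 + regs s 11))%N by rewrite expnD.
  by rewrite ltn_exp2l //; lia.
have rJ : regs s 0 = J by case: st.
have [rec ft qt] := radix2_ifft_dft x rJ; set u := run _ radix2_ifft s in rec ft qt *.
have [fs qs] := w; split=> //.
  have cJ : (ifft_cost J <= 3 * level_cost e)%N.
    apply: leq_trans (ifft_cost_le J) (leq_trans _ (level_cost_next e)).
    exact: level_cost_mono.
  rewrite ft; have := sumF J.-1; move: fs; set S := (\sum_(i < J.-1) _)%N.
  have := leq_pred J; nia.
have qJ : (2 ^ J <= 2 * 2 ^ e)%N by rewrite -expnS leq_exp2l.
rewrite qt; have := sumS J.-1; move: qs; set S := (\sum_(i < J.-1) _)%N.
have := leq_pred J; nia.
Qed.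

(** The support then lies in an interval of length [2 ^ (J - 2)] at every level
    from [J - 2] on, in particular at the last level of [detect]. *)
Lemma detect_short (R : realType) J (x : 'cV[R]_(2 ^ J)) m :
  (0 < J)%N -> nonneg_vec x -> support_length x m -> (4 * m <= 2 ^ J)%N ->
  regs (run (dft x) detect (init_state R J)) 18 = 0%N.
Proof.
move=> J0 x0 [_ m0 [mu _ van] _] m4.
have J2 : (1 < J)%N by case: J J0 m4 {x x0 van} => [|[|J]] //; lia.
have JE : (2 ^ J = 4 * 2 ^ (J - 2))%N by rewrite (_ : 4 = 2 ^ 2)%N // -expnD subnKC.
have cov : covers x (J - 2) by apply: covers_support van _; lia.
have [_ loc _ ->] := detect_spec J0 x0 cov.
have jJ : (J.-1 < J)%N by rewrite prednK.
set s := run _ _ _ in loc *; apply/eqP; rewrite subn_eq0 JE leq_pmul2l // leq_exp2l //.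
by have := located_le cov jJ loc; rewrite leq_min => /andP[].
Qed.

(** Otherwise the support at level [J.-1] would lie in an interval of length
    [2 ^ J / 4], and that of [x] in one of length [2 ^ J / 4 + 2 ^ J / 2]. *)
Lemma detect_long (R : realType) J (x : 'cV[R]_(2 ^ J)) m :
  (0 < J)%N -> nonneg_vec x -> support_length x m -> (3 * 2 ^ J < 4 * m)%N ->
  (0 < regs (run (dft x) detect (init_state R J)) 18)%N.
Proof.
case: J x => // J x _ x0 [_ m0 _ min] m34.
have cov : covers x J.+1 by move=> j jJ Jj; move: (leq_trans jJ Jj); rewrite ltnn.
have [_ [_ muj lj fit _] _ ->] := detect_spec (ltn0Sn J) x0 cov.
set s := run _ _ _ in muj lj fit *; rewrite subn_gt0 ltnNge; apply: contraL m34 => short.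
rewrite -leqNgt; have van := fits_vanishes x0 muj lj fit.
have mu2 : (regs s 10 < 2 ^ J.+1)%N by apply: leq_trans muj _; rewrite leq_exp2l.
have := min _ _ _ mu2 van; rewrite addn_gt0 expn_gt0 => /(_ isT).
rewrite expnS in short *; rewrite -[J.+1.-1]/J in lj short *; lia.
Qed.

(** * Logarithmic bounds *)

Lemma log2_exp (R : realType) n : log2 ((2 ^ n)%:R : R) = n%:R.
Proof.
have l2 : ln (2 : R) != 0 by rewrite gt_eqF // ln_gt0 // ltr1n.
by rewrite /log2 natrX lnXn // -[_ *+ n]mulr_natr mulrAC mulfV // mul1r.
Qed.

Lemma log2_mono (R : realType) (a b : R) : 0 < a -> a <= b -> log2 a <= log2 b.
Proof.
move=> a0 ab; rewrite /log2 ler_pM2r ?invr_gt0 ?ln_gt0 ?ltr1n //.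
by rewrite ler_ln ?posrE // (lt_le_trans a0).
Qed.

Lemma log2_div (R : realType) (a b : R) : 0 < a -> 0 < b ->
  log2 (a / b) = log2 a - log2 b.
Proof. by move=> a0 b0; rewrite /log2 ln_div ?posrE // mulrBl. Qed.

(** With [2 ^ e] the least power of two that is at least [m], the logarithms of
    [m] and [N / m] are those of [2 ^ e] and [N / 2 ^ e] up to 1. *)
Lemma level_bounds (R : realType) J m :
  (0 < m)%N -> (m <= 2 ^ J)%N ->
  let e := up_log 2 m in
  [/\ ((2 ^ e)%:R : R) <= 2 * m%:R,
      (e%:R : R) <= 1 + log2_factor (m%:R : R) &
      ((J - e)%:R : R) <= log2_factor ((2 ^ J)%:R / m%:R : R)].
Proof.
move=> m0 mJ e; have mR0 : 0 < (m%:R : R) by rewrite ltr0n.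
have eJ : (e <= J)%N by apply: up_log_min.
have me : (m <= 2 ^ e)%N by apply: up_logP.
have e2m : (2 ^ e <= 2 * m)%N.
  have [m1|m1] := leqP m 1; first by rewrite /e (_ : m = 1%N) ?up_log1 //; lia.
  have e_gt0 : (0 < e)%N by rewrite up_log_gt0.
  by rewrite -(prednK e_gt0) expnS leq_mul2l ltnW // up_log_gtn.
split; first by rewrite -natrM ler_nat.
  apply: (@le_trans _ _ (1 + log2 (m%:R : R))); last by rewrite lerD2l le_max lexx orbT.
  rewrite -lerBlDl -[X in _ - X]/(1%:R) -(log2_exp R e) -(log2_exp R 1) -log2_div ?ltr0n ?expn_gt0 //.
  apply: log2_mono; first by rewrite divr_gt0 ?ltr0n ?expn_gt0.
  by rewrite ler_pdivrMr ?ltr0n // -natrM ler_nat mulnC.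
apply: (@le_trans _ _ (log2 ((2 ^ J)%:R / m%:R : R))); last by rewrite le_max lexx orbT.
rewrite log2_div ?ltr0n ?expn_gt0 // log2_exp natrB // lerD2l lerN2 -(log2_exp R e).
by apply: log2_mono => //; rewrite ler_nat.
Qed.

(** Constants: [2 e + 10 <= 14 A], [k + 5 <= 6 B] and [2 ^ e <= 2 M], where
    [168 = 2 * 14 * 6]. *)
Lemma level_cost_real (R : realType) e k (M A B : R) :
  (2 ^ e)%:R <= 2 * M -> e%:R <= 1 + A -> k%:R <= B -> 1 <= A -> 1 <= B ->
  (level_cost e * (k + 5))%:R <= 168 * (M * A * B) /\
  (2 ^ e * (k + 4))%:R <= 168 * (M * B).
Proof.
move=> eM eA kB A1 B1.
have M0 : 0 <= M by have := ler0n R (2 ^ e); lra.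
have fA : (2 * e + 10)%:R <= 14 * A by rewrite natrD natrM; lra.
have fB : (k + 5)%:R <= 6 * B by rewrite natrD; lra.
have fB4 : (k + 4)%:R <= 5 * B by rewrite natrD; lra.
rewrite /level_cost !natrM; split.
  have -> : 168 * (M * A * B) = (2 * M) * (14 * A) * (6 * B) by ring.
  by rewrite ler_pM ?mulr_ge0 ?ler0n // ler_pM ?ler0n.
apply: (@le_trans _ _ ((2 * M) * (5 * B))); first by rewrite ler_pM ?ler0n.
have MB : 0 <= M * B by rewrite mulr_ge0 //; lra.
by lra.
Qed.

Theorem mainTheorem1 (R : realType) :
  exists (detect sparse : prog) (flag : nat) (C theta1 theta2 : R),
    let alg := Then detect
                 (IfIndexLe (IVar flag) (INum 0) sparse radix2_ifft) in
    [/\ 0 < theta1, theta1 <= theta2, theta2 < 1 &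
    forall (J : nat) (x : 'cV[R]_(2 ^ J)),
      (0 < J)%N -> nonneg_vec x ->
      let N := (2 ^ J)%N in
      let detected := run (dft x) detect (init_state R J) in
      let final := run (dft x) alg (init_state R J) in
      [/\ (* recovery *)
          forall k : 'I_(2 ^ J), output final k = (x k 0)%:C,
          (* (i) *)
          forall m : nat, support_length x m -> (m < N)%N ->
            (flops final)%:R
              <= C * (m%:R * log2_factor (m%:R : R)
                           * log2_factor (N%:R / m%:R : R)) /\
            (samples final)%:R <= C * (m%:R * log2_factor (N%:R / m%:R : R)),
          (* (ii): short support is recognized, and the algorithm falls back
             to the radix-2 FFT for (almost) full support *)
          forall m : nat, support_length x m ->
            (m%:R <= theta1 * N%:R -> regs detected flag = 0%N) /\
            (theta2 * N%:R < m%:R -> (0 < regs detected flag)%N)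
        & (* (ii): complexity in all cases *)
          (flops final)%:R <= C * (N%:R * log2 (N%:R : R))]].
Proof.
(* 168 is the constant of level_cost_real *)
exists detect, refine, 18%N, 168, (1 / 4), (3 / 4) => alg.
split; [lra | lra | lra |] => J x J0 x0 N detected final.
(* for the bound in N, no interval shorter than the full circle is used *)
have cov_full : covers x J by move=> j jJ; rewrite leqNgt jJ.
have [rec flops_all _] := algorithm_spec J0 x0 (leqnn J) cov_full.
split.
- exact: rec.
- move=> m sm mN; have [_ m0 [mu _ van] _] := sm.
  have [e2 eA kB] := level_bounds R m0 (ltnW mN).
  have e_le : (up_log 2 m <= J)%N by apply: up_log_min => //; apply: ltnW.
  have cov := covers_support van (up_logP m (isT : 1 < 2)%N).
  have [_ fs qs] := algorithm_spec J0 x0 e_le cov.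
  have lf1 t : 1 <= log2_factor (t : R) by rewrite le_max lexx.
  have [fR qR] := level_cost_real e2 eA kB (lf1 _) (lf1 _).
  split; first by apply: le_trans fR; rewrite ler_nat.
  by apply: le_trans qR; rewrite ler_nat.
- move=> m sm; split=> mN.
    apply: (detect_short J0 x0 sm); rewrite -(ler_nat R) natrM; lra.
  apply: (detect_long J0 x0 sm); rewrite -(ltr_nat R) !natrM; lra.
rewrite /N log2_exp -!natrM ler_nat; apply: leq_trans flops_all _.
by rewrite subnn /level_cost; have := expn_gt0 2 J; nia.
Qed.
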